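(* Let $K$ be a field, $1\le d\le n$, and let $I=I_{n,d}\subset S=K[x_1,\dots,x_n]$ be the ideal generated by all squarefree monomials of degree $d$. Then: (a) $I^{(k)}$ has linear quotients, and so it is componentwise linear, for all $k\ge1$. (b) $\mathrm{reg}\,I^{(k)}=\mathrm{reg}\,I^k=dk$ for all $k\ge1$.
   Context: $S$ is standard graded; $\mathrm{reg}$ is Castelnuovo–Mumford regularity. The $k$th symbolic power is $I^{(k)}=\bigcap_{P\in\mathrm{Ass}(I)}(I^kS_P\cap S)$, with $\mathrm{Ass}(I)=\mathrm{Ass}(S/I)$. A monomial ideal $L$ has linear quotients if its minimal monomial generators can be ordered $u_1,\dots,u_s$ so that $(u_1,\dots,u_{i-1}):(u_i)$ is generated by variables for $i=2,\dots,s$. A graded ideal $L$ is componentwise linear if for each $j$ the ideal generated by all homogeneous elements of $L$ of degree $j$ has a linear resolution. *)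

(* Defs.v *)
From HB Require Import structures.
From mathcomp Require Import all_boot all_order all_algebra.
From mathcomp Require Export fraction.
From mathcomp.multinomials Require Export mpoly.
Set Implicit Arguments.
Unset Strict Implicit.
Unset Printing Implicit Defensive.
Import GRing.Theory.
Local Open Scope ring_scope.

Local Notation "x %:F" := (tofrac x).

(* Ideals are Prop-valued membership predicates; equality of ideals is
   extensional.  Graded free modules are modules of row vectors, and matrices
   act on them by right multiplication. *)

Definition ideal_eq (R : comNzRingType) (I J : R -> Prop) : Prop :=
  forall f, I f <-> J f.

Definition is_ideal (R : comNzRingType) (I : R -> Prop) : Prop :=
  [/\ I 0, forall f g, I f -> I g -> I (f + g) & forall a f, I f -> I (a * f)].

Definition is_prime (R : comNzRingType) (P : R -> Prop) : Prop :=
  [/\ is_ideal P, ~ P 1 & forall f g, P (f * g) -> P f \/ P g].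

Definition ideal_gen (R : comNzRingType) (G : R -> Prop) : R -> Prop :=
  fun f => exists s : seq (R * R),
    (forall c, c \in s -> G c.2) /\ f = \sum_(c <- s) c.1 * c.2.

Definition ideal_pow (R : comNzRingType) (I : R -> Prop) (k : nat) : R -> Prop :=
  ideal_gen (fun f => exists g : 'I_k -> R,
    (forall i, I (g i)) /\ f = \prod_(i < k) g i).

Definition colon (R : comNzRingType) (I J : R -> Prop) : R -> Prop :=
  fun f => forall g, J g -> I (f * g).

(* P belongs to Ass(R/I): it is a prime which is the annihilator of the class
   of some f in R/I. *)
Definition ass (R : comNzRingType) (I P : R -> Prop) : Prop :=
  is_prime P /\ exists f, forall g, P g <-> I (g * f).

(* R is a domain, so R_P is taken inside the fraction field of R. *)
Definition local_ring (R : idomainType) (P : R -> Prop) : {fraction R} -> Prop :=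
  fun q => exists a s, ~ P s /\ q = a%:F / s%:F.

Definition local_ext (R : idomainType) (I P : R -> Prop) : {fraction R} -> Prop :=
  fun q => exists s : seq ({fraction R} * R),
    (forall c, c \in s -> local_ring P c.1 /\ I c.2) /\
    q = \sum_(c <- s) c.1 * c.2%:F.

Definition symbolic_pow (R : idomainType) (I : R -> Prop) (k : nat) : R -> Prop :=
  fun f => forall P, ass I P -> local_ext (ideal_pow I k) P f%:F.

Definition monom_ideal (K : fieldType) (n : nat) (s : seq 'X_{1..n}) :
    {mpoly K[n]} -> Prop :=
  ideal_gen (fun f => exists2 m, m \in s & f = 'X_[m]).

Definition vars_ideal (K : fieldType) (n : nat) (A : {set 'I_n}) :
    {mpoly K[n]} -> Prop :=
  ideal_gen (fun f => exists2 i, i \in A & f = 'X_i).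

Definition sqfree_veronese (K : fieldType) (n d : nat) : {mpoly K[n]} -> Prop :=
  ideal_gen (fun f => exists m : 'X_{1..n},
    [/\ mdeg m = d, forall i, (m i <= 1)%N & f = 'X_[m]]).

Definition min_monom_gens (K : fieldType) (n : nat) (L : {mpoly K[n]} -> Prop)
    (s : seq 'X_{1..n}) : Prop :=
  [/\ uniq s, ideal_eq L (monom_ideal s) &
      forall t, {subset t <= s} -> ideal_eq L (monom_ideal t) ->
        {subset s <= t}].

Definition linear_quotients (K : fieldType) (n : nat)
    (L : {mpoly K[n]} -> Prop) : Prop :=
  exists s : seq 'X_{1..n}, min_monom_gens L s /\
    forall i, (0 < i < size s)%N ->
      exists A : {set 'I_n},
        ideal_eq (colon (@monom_ideal K n (take i s))
                        (monom_ideal [:: nth 0%MM s i]))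
                 (vars_ideal A).

(* The data of a sequence of maps  ... -> F_1 -> F_0 -> S  where
   F_i = \bigoplus_a S(- res_deg i a). *)
Record res_data (K : fieldType) (n : nat) := ResData {
  res_rank : nat -> nat;
  res_deg : forall i, 'I_(res_rank i) -> nat;
  res_aug : 'cV[{mpoly K[n]}]_(res_rank 0);
  res_map : forall i, 'M[{mpoly K[n]}]_(res_rank i.+1, res_rank i) }.

(* F is a minimal graded free resolution of the ideal L. *)
Record min_graded_res (K : fieldType) (n : nat) (F : res_data K n)
    (L : {mpoly K[n]} -> Prop) : Prop := MinGradedRes {
  res_aug_graded : forall a, res_aug F a 0 \is (res_deg a).-homog;
  (* nonzero entries S(-a) -> S(-b) are homogeneous of degree a - b >= 0 *)
  res_map_graded : forall i a b m, m \in msupp (res_map F i a b) ->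
    (mdeg m + res_deg b)%N = res_deg a;
  res_aug_image : forall f,
    L f <-> exists v : 'rV_(res_rank F 0), f = (v *m res_aug F) 0 0;
  res_exact0 : forall v : 'rV_(res_rank F 0),
    v *m res_aug F = 0 <-> exists w, v = w *m res_map F 0;
  res_exact : forall i (v : 'rV_(res_rank F i.+1)),
    v *m res_map F i = 0 <-> exists w, v = w *m res_map F i.+1;
  res_minimal : forall i a b, vars_ideal [set: 'I_n] (res_map F i a b) }.

(* reg L = r: the maximum of j - i over the summands S(-j) of F_i in a minimal
   graded free resolution F of L is r.  Such an F is unique up to isomorphism,
   so r does not depend on it. *)
Definition has_reg (K : fieldType) (n : nat) (L : {mpoly K[n]} -> Prop)
    (r : nat) : Prop :=
  exists F : res_data K n, [/\ min_graded_res F L,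
    forall i (a : 'I_(res_rank F i)), (res_deg a <= r + i)%N &
    exists i (a : 'I_(res_rank F i)), res_deg a = (r + i)%N].

(* F_i = S(-(q + i))^(b_i) for all i. *)
Definition linear_resolution (K : fieldType) (n : nat)
    (L : {mpoly K[n]} -> Prop) : Prop :=
  exists q, exists2 F : res_data K n, min_graded_res F L &
    forall i (a : 'I_(res_rank F i)), res_deg a = (q + i)%N.

Definition graded_ideal (K : fieldType) (n : nat)
    (L : {mpoly K[n]} -> Prop) : Prop :=
  ideal_eq L (ideal_gen (fun f => L f /\ exists j, f \is j.-homog)).

Definition componentwise_linear (K : fieldType) (n : nat)
    (L : {mpoly K[n]} -> Prop) : Prop :=
  graded_ideal L /\
  forall j, linear_resolution (ideal_gen (fun f => L f /\ f \is j.-homog)).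

(* Main.v *)
(** The monomials of [I^(k)] are those whose exponents on every set of
    [n - d + 1] variables sum to at least [k], and the monomials [x^m] of [I^k] are
    those with [\sum_i min(m_i, k) >= d k].  Both sets, and their homogeneous
    components, are "shifted": if [u_j < u_i], then [u x_j / x_i] is again in the
    set.

    If the minimal generators of a shifted monomial ideal are ordered by degree,
    then by [\sum_i u_i^2], then with lexicographically larger monomials first, each
    colon ideal [(earlier generators) : u] is generated by variables.

    Linear quotients in nondecreasing degrees yield the minimal resolution
    without mapping cones.  Let the rows of [M] be generators [g_1, ..., g_s] with
    [(g_1, ..., g_(i-1)) : g_i] generated by the variables in [A_i].  The syzygies
    [x_l e_i - ...], for [l] in [A_i], generate the syzygy module, which again has
    linear quotients, and each has degree [deg g_i + 1].  Iterating gives a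
    resolution with generators in degrees [deg g_i + p] in step [p], so the
    regularity is the largest degree of a minimal generator, here [d k]. *)

Require Import Defs.
From mathcomp Require Import all_boot all_order all_algebra.
From mathcomp Require Import zify.
From Stdlib Require Import ClassicalEpsilon.
Set Implicit Arguments.
Unset Strict Implicit.
Unset Printing Implicit Defensive.
Import Order.TTheory GRing.Theory.

(** * Ideals and monomial ideals *)

Section Ideals.
Local Open Scope ring_scope.
Variable R : comNzRingType.
Implicit Types (G I : R -> Prop) (f g : R).

Lemma ideal_gen_incl G f : G f -> ideal_gen G f.
Proof.
move=> Gf; exists [:: (1, f)]; split; first by move=> c; rewrite inE => /eqP->.
by rewrite big_seq1 mul1r.
Qed.

Lemma ideal_sum I (T : eqType) (s : seq T) (F : T -> R) :
  is_ideal I -> {in s, forall t, I (F t)} -> I (\sum_(t <- s) F t).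
Proof.
case=> I0 ID _; elim: s => [|t s IHs] sF; first by rewrite big_nil.
rewrite big_cons; apply: ID; first by apply: sF; rewrite mem_head.
by apply: IHs => u us; apply: sF; rewrite inE us orbT.
Qed.

Lemma ideal_gen_sub G I :
  is_ideal I -> (forall f, G f -> I f) -> forall f, ideal_gen G f -> I f.
Proof.
move=> idI GI f [s [sG ->]]; apply: ideal_sum => // c /sG /GI.
by case: idI => _ _; apply.
Qed.

Lemma ideal_gen_ideal G : is_ideal (ideal_gen G).
Proof.
split=> [|f g [s [sG ->]] [t [tG ->]]|a f [s [sG ->]]].
- by exists [::]; rewrite big_nil.
- exists (s ++ t); rewrite big_cat; split=> // c.
  by rewrite mem_cat => /orP[/sG | /tG].
- exists [seq (a * c.1, c.2) | c <- s]; split=> [c /mapP[e /sG Ge ->] //|].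
  by rewrite big_map mulr_sumr; apply: eq_bigr => c _; rewrite mulrA.
Qed.

End Ideals.

Section MonomialIdeals.
Local Open Scope ring_scope.
Variables (K : fieldType) (n : nat).
Implicit Types (f : {mpoly K[n]}) (m u : 'X_{1..n}).

(** Monomial ideals are handled as [supported_in Q] with [Q] an upward closed set of exponents, so
    that membership becomes a condition on each monomial. *)
Definition supported_in (Q : 'X_{1..n} -> Prop) : {mpoly K[n]} -> Prop :=
  fun f => forall m, m \in msupp f -> Q m.

Definition mupclosed (Q : 'X_{1..n} -> Prop) :=
  forall u m, Q u -> (u <= m)%MM -> Q m.

Lemma supported_inX Q m : supported_in Q 'X_[m] <-> Q m.
Proof.
by split=> [|Qm u]; [apply; rewrite msuppX inE | rewrite msuppX inE => /eqP->].
Qed.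

Lemma supported_in_ideal Q : mupclosed Q -> is_ideal (supported_in Q).
Proof.
move=> upQ; split=> [m|f g sf sg m /msuppD_le|a f sf m /msuppM_le].
- by rewrite mcoeff_msupp mcoeff0 eqxx.
- by rewrite mem_cat => /orP[/sf | /sg].
- case/allpairsP=> -[m1 m2] /= [_ /sf Qm2 ->].
  by apply: upQ Qm2 _; apply: lem_addl.
Qed.

Lemma ideal_monomials (I : {mpoly K[n]} -> Prop) f :
  is_ideal I -> supported_in (fun m => I 'X_[m]) f -> I f.
Proof.
move=> idI sf; rewrite [f]mpolyE; apply: ideal_sum => // m /sf.
by rewrite -mul_mpolyC; case: idI => _ _; apply.
Qed.

Lemma ideal_genXP (Q : 'X_{1..n} -> Prop) (G : {mpoly K[n]} -> Prop) :
    (forall f, G f <-> exists2 u, Q u & f = 'X_[u]) ->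
  forall f, ideal_gen G f <->
    supported_in (fun m => exists2 u, Q u & (u <= m)%MM) f.
Proof.
move=> GQ f; split.
  apply: ideal_gen_sub => [|g /GQ[u Qu ->]]; last first.
    by apply/supported_inX; exists u; rewrite ?lepm_refl.
  apply: supported_in_ideal => u m [v Qv le_vu] le_um.
  by exists v => //; apply: lepm_trans le_vu le_um.
move=> sf; apply: ideal_monomials (ideal_gen_ideal _) _ => m /sf[u Qu le_um].
rewrite -(submK le_um) mpolyXD; have [_ _] := ideal_gen_ideal G; apply.
by apply: ideal_gen_incl; apply/GQ; exists u.
Qed.

Lemma monom_idealP (s : seq 'X_{1..n}) f :
  monom_ideal s f <-> supported_in (fun m => has (fun u => (u <= m)%MM) s) f.
Proof.
apply: (iff_trans (ideal_genXP (Q := fun u => u \in s) _ f)) => //.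
by split=> sf m /sf; [case=> u us um; apply/hasP; exists u | case/hasP=> u; exists u].
Qed.

Lemma vars_idealP (A : {set 'I_n}) f :
  vars_ideal A f <-> supported_in (fun m => exists2 i, i \in A & (0 < m i)%N) f.
Proof.
apply: (iff_trans (ideal_genXP (Q := fun u => exists2 i, i \in A & u = U_(i)%MM) _ f)).
  by move=> g; split=> [[i iA ->]|[u [i iA ->] ->]]; [exists U_(i)%MM => //|]; exists i.
split=> sf m /sf.
  by case=> u [i iA ->]; rewrite lep1mP -lt0n; exists i.
case=> i iA mi; exists U_(i)%MM; last by rewrite lep1mP -lt0n.
by exists i.
Qed.

Lemma vars_ideal_sum (A : {set 'I_n}) f :
  vars_ideal A f -> exists c : 'I_n -> {mpoly K[n]}, f = \sum_(i in A) c i * 'X_i.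
Proof.
apply: (@ideal_gen_sub _ _
  (fun f => exists c : 'I_n -> {mpoly K[n]}, f = \sum_(i in A) c i * 'X_i)).
  split=> [|g h [c ->] [e ->]|a g [c ->]].
  - by exists (fun=> 0); rewrite big1 // => i _; rewrite mul0r.
  - by exists (fun i => c i + e i); rewrite -big_split; apply: eq_bigr => i _; rewrite mulrDl.
  - by exists (fun i => a * c i); rewrite mulr_sumr; apply: eq_bigr => i _; rewrite mulrA.
move=> g [i iA ->]; exists (fun j => (j == i)%:R).
by rewrite (bigD1 i) //= eqxx mul1r big1 ?addr0 // => j /andP[_ /negPf->]; rewrite mul0r.
Qed.

(** Serves both for homogeneous components and for the components of a given weight. *)
Definition mrestrict (P : pred 'X_{1..n}) f : {mpoly K[n]} :=
  \sum_(m <- msupp f | P m) f@_m *: 'X_[m].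

Lemma mcoeff_mrestrict P f m : (mrestrict P f)@_m = if P m then f@_m else 0.
Proof.
rewrite /mrestrict raddf_sum /=.
under eq_bigr => u _ do rewrite mcoeffZ mcoeffX.
case: (boolP (m \in msupp f)) => [mf|]; last first.
  move=> mf; rewrite (memN_msupp_eq0 mf) if_same big_seq_cond big1 // => u /andP[uf _].
  by case: eqP => [eq_um|_]; [rewrite -eq_um uf in mf | rewrite mulr0].
case: ifP => [Pm|Pm].
  rewrite big_mkcond (bigD1_seq m) ?msupp_uniq //= Pm eqxx mulr1 big1 ?addr0 // => u /negPf->.
  by rewrite mulr0 if_same.
by rewrite big1 // => u Pu; case: eqP => [eq_um|_]; [rewrite -eq_um Pu in Pm | rewrite mulr0].
Qed.

Lemma msupp_mrestrict P f m : (m \in msupp (mrestrict P f)) = P m && (m \in msupp f).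
Proof. by rewrite !mcoeff_msupp mcoeff_mrestrict; case: ifP; rewrite ?eqxx. Qed.

Lemma mrestrict_split P f : f = mrestrict P f + mrestrict (predC P) f.
Proof. by rewrite {1}[f]mpolyE (bigID P). Qed.

End MonomialIdeals.

(** * Syzygies of modules with linear quotients *)

Section RowSpan.
Local Open Scope ring_scope.
Variables (R : comNzRingType) (s r : nat) (M : 'M[R]_(s, r)).
Implicit Types (Q : pred 'I_s) (v : 'rV[R]_r).

(** The predicate selects the rows that may be used, so that the span of the earlier rows is
    expressed without a submatrix. *)
Definition in_rowspan Q v :=
  exists w : 'rV[R]_s, (forall j, ~~ Q j -> w 0 j = 0) /\ v = w *m M.

Lemma in_rowspan0 Q : in_rowspan Q 0.
Proof. by exists 0; rewrite mul0mx; split=> // j _; rewrite mxE. Qed.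

Lemma in_rowspanD Q v1 v2 :
  in_rowspan Q v1 -> in_rowspan Q v2 -> in_rowspan Q (v1 + v2).
Proof.
move=> [w1 [Q1 ->]] [w2 [Q2 ->]]; exists (w1 + w2); rewrite mulmxDl; split=> // j Qj.
by rewrite mxE Q1 // Q2 // addr0.
Qed.

Lemma in_rowspanZ Q a v : in_rowspan Q v -> in_rowspan Q (a *: v).
Proof.
move=> [w [Qw ->]]; exists (a *: w); rewrite scalemxAl; split=> // j Qj.
by rewrite mxE Qw // mulr0.
Qed.

Lemma in_rowspan_sum Q (I : finType) (P : pred I) (F : I -> 'rV_r) :
  (forall i, P i -> in_rowspan Q (F i)) -> in_rowspan Q (\sum_(i | P i) F i).
Proof.
move=> QF; elim/big_rec: _ => [|i v Pi Qv]; first exact: in_rowspan0.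
by apply: in_rowspanD Qv; apply: QF.
Qed.

Lemma in_rowspan_row Q i : Q i -> in_rowspan Q (row i M).
Proof.
move=> Qi; exists (delta_mx 0 i); rewrite rowE; split=> // j nQj.
by rewrite mxE eqxx /=; case: eqP => // ji; rewrite ji Qi in nQj.
Qed.

Lemma in_rowspan_weaken Q1 Q2 v :
  (forall i, Q1 i -> Q2 i) -> in_rowspan Q1 v -> in_rowspan Q2 v.
Proof.
by move=> Q12 [w [Qw ->]]; exists w; split=> // j /(contra (Q12 j)) /Qw.
Qed.

End RowSpan.

(** * Lexicographic enumeration of pairs *)

Section PairEnumeration.

Definition pair_lt s n (p q : 'I_s * 'I_n) :=
  (p.1 < q.1) || (p.1 == q.1) && (p.2 < q.2).

(** The pairs [(i, l)] index the leading terms [x_l e_i] of the syzygies. Ordering them by [i] first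
    keeps the degrees nondecreasing. *)
Lemma enum_pairs s n (A : 'I_s -> {set 'I_n}) :
  exists N (p : 'I_N -> 'I_s * 'I_n),
    [/\ forall a, (p a).2 \in A (p a).1,
        forall i l, l \in A i -> exists a, p a = (i, l) &
        forall a b : 'I_N, (a < b) = pair_lt (p a) (p b)].
Proof.
(* As [q.2 < n], comparing these numbers is the lexicographic comparison of pairs. *)
pose key (q : 'I_s * 'I_n) := q.1 * n + q.2.
have keyE q q' : (key q < key q') = pair_lt q q'.
  rewrite /key /pair_lt -val_eqE; case: q q' => [i l] [j m] /=.
  have := ltn_ord l; have := ltn_ord m; move: (val i) (val j) (val l) (val m) => x y z t.
  case: (ltngtP x y) => [lt|lt|->] //=; last by rewrite ltn_add2l.
    by have := leq_mul lt (leqnn n); nia.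
  by have := leq_mul lt (leqnn n); nia.
have key_inj : injective key.
  case=> i l [j m] eq_key; have := keyE (i, l) (j, m); have := keyE (j, m) (i, l).
  rewrite eq_key ltnn /pair_lt /= -!val_eqE /= eq_sym.
  case: (ltngtP i j) => //= /val_inj <-; case: (ltngtP l m) => //= /val_inj <- //.
pose P := sort (relpre key leq) (enum [set q : 'I_s * 'I_n | q.2 \in A q.1]).
have memP q : (q \in P) = (q.2 \in A q.1) by rewrite mem_sort mem_enum inE.
have ltP a b : a < b -> b < size P -> forall x0, key (nth x0 P a) < key (nth x0 P b).
  move=> lt_ab lt_b x0.
  have uP : uniq (map key P) by rewrite map_inj_uniq // sort_uniq enum_uniq.
  have : sorted ltn (map key P).
    rewrite ltn_sorted_uniq_leq uP sorted_map.
    by apply: sort_sorted => x y; apply: leq_total.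
  move/(sorted_ltn_nth ltn_trans 0)/(_ a b); rewrite !inE size_map.
  rewrite (ltn_trans lt_ab lt_b) lt_b => /(_ isT isT lt_ab).
  by rewrite !(nth_map x0) // (ltn_trans lt_ab lt_b).
exists (size P), (tnth (in_tuple P)); split=> [a|i l lA|a b].
- by rewrite -memP mem_tnth.
- have iP : (i, l) \in P by rewrite memP.
  have lt_i := iP; rewrite -index_mem in lt_i.
  by exists (Ordinal lt_i); rewrite (tnth_nth (i, l)) nth_index.
- have x0 : 'I_s * 'I_n := tnth (in_tuple P) a.
  rewrite -keyE !(tnth_nth x0) /=; case: (ltngtP a b) => [lt|lt|->]; last by rewrite ltnn.
    by rewrite ltP.
  by have := ltP _ _ lt (ltn_ord a) x0; lia.
Qed.

End PairEnumeration.

(** * Graded modules with linear quotients and their syzygies *)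

Section Syzygies.
Local Open Scope ring_scope.
Variables (K : fieldType) (n : nat).
Local Notation S := {mpoly K[n]}.

(** The rows of [lq_M] generate a graded submodule of the sum of the [S(- d b)], row [i] having
    degree [lq_e i]. The conditions pass to the syzygy module, and the sorted degrees make the
    resulting maps minimal. *)
Record lq_module (r : nat) (d : 'I_r -> nat) := LQModule {
  lq_s : nat;
  lq_e : 'I_lq_s -> nat;
  lq_A : 'I_lq_s -> {set 'I_n};
  lq_M : 'M[S]_(lq_s, r);
  lq_graded : forall i b m, m \in msupp (lq_M i b) -> (mdeg m + d b)%N = lq_e i;
  lq_sorted : forall i j : 'I_lq_s, (i <= j)%N -> (lq_e i <= lq_e j)%N;
  lq_colon : forall (i : 'I_lq_s) f,
    in_rowspan lq_M (fun j : 'I_lq_s => (j < i)%N) (f *: row i lq_M) <->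
    vars_ideal (lq_A i) f }.

Arguments lq_e {r d} _ _.
Arguments lq_A {r d} _ _.

(** The component of degree [D] in [S(- c)]; writing [mdeg m + c] avoids truncated subtraction. *)
Definition graded_part (D c : nat) (f : S) : S :=
  mrestrict (fun m => mdeg m + c == D)%N f.

Lemma mcoeff_graded_part D c f m :
  (graded_part D c f)@_m = if (mdeg m + c == D)%N then f@_m else 0.
Proof. exact: mcoeff_mrestrict. Qed.

Lemma graded_part_id D c f :
  (forall m, m \in msupp f -> (mdeg m + c)%N = D) -> graded_part D c f = f.
Proof.
move=> Df; apply/mpolyP => m; rewrite mcoeff_graded_part.
case: eqP => // nD; rewrite memN_msupp_eq0 //; by apply/negP => /Df.
Qed.

Lemma graded_partM D b c f g :
    (forall m, m \in msupp g -> (mdeg m + b)%N = c) ->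
  graded_part D b (f * g) = graded_part D c f * g.
Proof.
move=> gc; apply/mpolyP => m; rewrite mcoeff_graded_part !mcoeffM.
case: ifP => Dm; [apply: eq_bigr|rewrite big1 //] => k /eqP mE.
all: rewrite mcoeff_graded_part.
all: case: (boolP (bmnm k.2 \in msupp g)) => [kg|/memN_msupp_eq0 ->]; last by rewrite !mulr0.
all: have dE : (mdeg m + b)%N = (mdeg k.1 + c)%N
       by have := congr1 (fun u => mdeg u + b)%N mE; rewrite /= mdegD -addnA (gc _ kg).
all: by rewrite -dE Dm ?mul0r.
Qed.

Lemma graded_part_sum D c (I : finType) (F : I -> S) :
  graded_part D c (\sum_i F i) = \sum_i graded_part D c (F i).
Proof.
apply/mpolyP => m; rewrite mcoeff_graded_part !raddf_sum /=.
case: ifP => Dm; [apply: eq_bigr|rewrite big1 //] => i _.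
all: by rewrite mcoeff_graded_part Dm.
Qed.

Variables (r : nat) (d : 'I_r -> nat) (X : lq_module d).
Local Notation s := (lq_s X).
Local Notation e := (lq_e X).
Local Notation A := (lq_A X).
Local Notation M := (lq_M X).

(** The colon condition gives some [w]. Since ['X_l *: row i M] and the rows of [M] are homogeneous,
    the components of [w] in degree [e i + 1] satisfy the same identity. *)
Lemma homogeneous_lift (i : 'I_s) (l : 'I_n) : l \in A i ->
  exists w : 'rV[S]_s, [/\ forall j : 'I_s, (i <= j)%N -> w 0 j = 0,
    forall j m, m \in msupp (w 0 j) -> (mdeg m + e j)%N = (e i).+1 &
    'X_l *: row i M = w *m M].
Proof.
move=> lA; have /lq_colon[w [w0 wM]] : vars_ideal (A i) ('X_l : S).
  by apply: ideal_gen_incl; exists l.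
exists (\row_j graded_part (e i).+1 (e j) (w 0 j)); split=> [j le_ij|j m|].
- rewrite mxE w0 -?leqNgt //; apply/mpolyP => m.
  by rewrite mcoeff_graded_part mcoeff0 if_same.
- by rewrite mxE mcoeff_msupp mcoeff_graded_part; case: ifP => [/eqP //|_]; rewrite eqxx.
- apply/rowP => b; move/rowP/(_ b): wM; rewrite !mxE => /(congr1 (graded_part (e i).+1 (d b))).
  rewrite graded_part_id => [->|m /msuppM_le]; last first.
    case/allpairsP=> -[m1 m2] /= []; rewrite msuppX inE => /eqP-> /lq_graded <- ->.
    by rewrite mdegD mdeg1 -addnA add1n.
  rewrite graded_part_sum; apply: eq_bigr => j _; rewrite mxE.
  by apply: graded_partM => m /lq_graded.
Qed.

(* The leading term of the syzygy h_(i,l) is x_l e_i.  The colon ideal of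
   h_(i,l) with respect to the preceding syzygies is therefore generated by the
   variables preceding x_l in A_i, so the syzygies are again of the same kind. *)
Lemma syzygy_lq : exists Y : lq_module e,
  [/\ forall v : 'rV[S]_s, v *m M = 0 <-> exists w, v = w *m lq_M Y,
      forall a b, vars_ideal [set: 'I_n] (lq_M Y a b) &
      forall a, exists i, lq_e Y a = (e i).+1].
Proof.
(* For [q.2] outside [A q.1] the value 0 is a placeholder that makes [W] total. *)
have /fin_all_exists[W Wp] : forall q : 'I_s * 'I_n, exists w : 'rV[S]_s, q.2 \in A q.1 ->
    [/\ forall j : 'I_s, (q.1 <= j)%N -> w 0 j = 0,
        forall j m, m \in msupp (w 0 j) -> (mdeg m + e j)%N = (e q.1).+1 &
        'X_(q.2) *: row q.1 M = w *m M].
  move=> [i l]; case: (boolP (l \in A i)) => [/homogeneous_lift[w Ww]|_]; last by exists 0.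
  by exists w.
pose h q : 'rV[S]_s := 'X_(q.2) *: delta_mx 0 q.1 - W q.
have hM q : q.2 \in A q.1 -> h q *m M = 0.
  by move=> /Wp[_ _ WM]; rewrite mulmxBl -scalemxAl -rowE WM subrr.
have h_top q : q.2 \in A q.1 -> h q 0 q.1 = 'X_(q.2).
  by move=> /Wp[W0 _ _]; rewrite !mxE !eqxx W0 // mulr1 subr0.
have h_above q (j : 'I_s) : q.2 \in A q.1 -> (q.1 < j)%N -> h q 0 j = 0.
  move=> /Wp[W0 _ _] lt_j; rewrite !mxE W0; last exact: ltnW.
  have -> : (j == q.1) = false by rewrite -val_eqE /= gtn_eqF.
  by rewrite andbF mulr0 subr0.
have scaleBE a1 a2 (v1 v2 : 'rV[S]_s) j :
  (a1 *: v1 - a2 *: v2) 0 j = a1 * v1 0 j - a2 * v2 0 j by rewrite !mxE.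
have [N [p [pA p_onto p_lt]]] := enum_pairs A.
pose H : 'M[S]_(N, s) := \matrix_(a, j) h (p a) 0 j.
have rowH a : row a H = h (p a) by apply/rowP => j; rewrite !mxE.
have HM a : row a H *m M = 0 by rewrite rowH hM.
(* Elimination from the last position downwards: since [v *m M = 0], the last entry of [v]
   multiplies its row into the span of the earlier ones. It is thus a combination of the [x_l] with
   [l] in [A io], and the same combination of the [h (io, l)] cancels it. *)
have H_gen (i : nat) v : v *m M = 0 -> (forall j : 'I_s, (i <= j)%N -> v 0 j = 0) ->
    in_rowspan H (fun a : 'I_N => ((p a).1 < i)%N) v.
  elim: i v => [|i IHi] v vM v0.
    suff -> : v = 0 by apply: in_rowspan0.
    by apply/rowP => j; rewrite v0 // mxE.
  case: (ltnP i s) => [lt_is|le_si]; last first.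
    apply: in_rowspan_weaken (IHi v vM _) => [a|j le_ij]; first exact: ltnW.
    by have := ltn_ord j; rewrite ltnNge (leq_trans le_si).
  pose io := Ordinal lt_is.
  have /vars_ideal_sum[c vE] : vars_ideal (A io) (v 0 io).
    apply/lq_colon; exists (v 0 io *: delta_mx 0 io - v); split=> [j|].
      rewrite -leqNgt leq_eqVlt => /orP[/eqP ij|lt_ij].
        have -> : j = io by apply: val_inj.
        by rewrite !mxE !eqxx mulr1 subrr.
      have jio : (j == io) = false by rewrite -val_eqE /= gtn_eqF.
      by rewrite !mxE (v0 j) // jio andbF mulr0 subr0.
    by rewrite mulmxBl vM subr0 -scalemxAl -rowE.
  pose t := \sum_(l in A io) c l *: h (io, l).
  rewrite -(subrK t v); apply: in_rowspanD.
    apply: in_rowspan_weaken (IHi _ _ _) => [a|| j]; first exact: ltnW.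
      rewrite mulmxBl vM mulmx_suml big1 ?subr0 // => l lA.
      by rewrite -scalemxAl hM // scaler0.
    rewrite leq_eqVlt => /orP[/eqP ij|lt_ij].
      have -> : j = io by apply: val_inj.
      rewrite !mxE vE summxE -sumrB big1 // => l lA.
      by rewrite mxE (h_top (io, l)) // subrr.
    rewrite !mxE v0 // summxE big1 ?subr0 // => l lA.
    by rewrite mxE (h_above (io, l)) // mulr0.
  apply: in_rowspan_sum => l /p_onto[a pa]; apply: in_rowspanZ.
  by rewrite -pa -rowH; apply: in_rowspan_row; rewrite pa.
have H_graded a j m : m \in msupp (H a j) -> (mdeg m + e j)%N = (e (p a).1).+1.
  have [_ We _] := Wp _ (pA a).
  rewrite !mxE eqxx /= => /msuppB_le; rewrite mem_cat => /orP[|/We //].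
  case: eqP => [->|_]; last by rewrite mulr0n mulr0 mcoeff_msupp mcoeff0 eqxx.
  by rewrite mulr1 msuppX inE => /eqP->; rewrite mdeg1 add1n.
have H_sorted (a b : 'I_N) : (a <= b)%N -> ((e (p a).1).+1 <= (e (p b).1).+1)%N.
  rewrite leq_eqVlt => /orP[/eqP/val_inj-> //|].
  rewrite p_lt => /orP[/ltnW/lq_sorted //|/andP[/eqP-> _] //].
have H_colon (a : 'I_N) f :
    in_rowspan H (fun b : 'I_N => (b < a)%N) (f *: row a H) <->
    vars_ideal [set l in A (p a).1 | (l < (p a).2)%N] f.
  split=> [[w [w0 wH]]|/vars_ideal_sum[c ->]].
    set V := vars_ideal _; have idV : is_ideal V := ideal_gen_ideal _.
    (* In coordinate [(p a).1], an earlier syzygy either vanishes or has as entry a smaller variable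
       from the same set [A (p a).1]. *)
    have [V0 _ VM] := idV; have : V (f * 'X_(p a).2).
      move/rowP/(_ (p a).1): wH; rewrite rowH mxE (h_top _ (pA a)) => ->; rewrite mxE.
      apply: ideal_sum idV _ => b _; have [lt_ba|le_ab] := ltnP b a; last first.
        by rewrite w0 -?leqNgt // mul0r.
      apply: VM; move: lt_ba; rewrite p_lt mxE => /orP[lt_p|/andP[/eqP eq_p lt_p]].
        by rewrite h_above.
      rewrite -eq_p (h_top _ (pA b)); apply: ideal_gen_incl; exists (p b).2 => //.
      by rewrite inE lt_p -eq_p pA.
    (* The variables generating [V] differ from ['X_(p a).2], which can therefore be cancelled. *)
    move=> /vars_idealP fX; apply/vars_idealP => m mf.
    have [|l lA] := fX (U_((p a).2) + m)%MM.
      by rewrite mcoeff_msupp mcoeffMX -mcoeff_msupp.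
    rewrite mnmDE mnm1E; have := lA; rewrite inE => /andP[_ lt_l].
    by rewrite -val_eqE gtn_eqF // add0n; exists l.
  rewrite scaler_suml; apply: in_rowspan_sum => l; rewrite inE => /andP[lA lt_l].
  rewrite -scalerA; apply: in_rowspanZ; have [b pb] := p_onto _ _ lA.
  have lt_ba : (b < a)%N by rewrite p_lt pb /pair_lt /= eqxx lt_l orbT.
  (* The leading terms of ['X_l *: row a H] and ['X_(p a).2 *: row b H] cancel, so their difference
     lives in positions before [(p a).1] and [H_gen] applies. *)
  rewrite -(subrK ('X_(p a).2 *: row b H) ('X_l *: _)); apply: in_rowspanD; last first.
    by apply: in_rowspanZ; apply: in_rowspan_row.
  apply: in_rowspan_weaken (H_gen (p a).1 _ _ _) => [c'|| j].
  - by rewrite p_lt /pair_lt => ->.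
  - by rewrite mulmxBl -!scalemxAl !HM !scaler0 subrr.
  have lbA : (p b).2 \in A (p b).1 by rewrite pA.
  rewrite !rowH leq_eqVlt => /orP[/eqP/val_inj <-|lt_j]; rewrite scaleBE.
    have := h_top _ lbA; rewrite pb /= => ->.
    by rewrite (h_top _ (pA a)) mulrC subrr.
  by rewrite (h_above _ _ (pA a)) // h_above ?pb // !mulr0 subrr.
pose Y := LQModule H_graded H_sorted H_colon.
exists Y; split=> [v|a b|a]; last by exists (p a).1.
  split=> [vM|[w ->]].
    by have [|w [_ ->]] := @H_gen s v vM _; [move=> j; rewrite leqNgt ltn_ord | exists w].
  rewrite -mulmxA; suff -> : H *m M = 0 by rewrite mulmx0.
  by apply/row_matrixP => a; rewrite row_mul HM row0.
apply/vars_idealP => m mH; have := H_graded _ _ _ mH.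
(* A nonzero entry forces [b <= (p a).1], so sortedness bounds [e b] below the row degree
   [(e (p a).1).+1]. Hence [m] is not constant. *)
have le_e : (e b <= e (p a).1)%N.
  case: (leqP b (p a).1) => [/lq_sorted //|lt_b].
  by move: mH; rewrite mxE h_above // mcoeff_msupp mcoeff0 eqxx.
have [/eqP m0|] := boolP (m == 0%MM); first by rewrite m0 mdeg0; lia.
move=> nz_m _; have : mdeg m != 0%N by rewrite mdeg_eq0.
rewrite mdegE sum_nat_eq0 negb_forall => /existsP[l nz_l].
by exists l; rewrite ?inE // lt0n.
Qed.

End Syzygies.

Arguments lq_e {K n r d} _ _.
Arguments lq_A {K n r d} _ _.

(** * Resolutions *)

Section Resolution.
Local Open Scope ring_scope.
Variables (K : fieldType) (n : nat).
Local Notation S := {mpoly K[n]}.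

(** Bundling the ambient free module makes taking syzygies an endofunction, which can be
    iterated. *)
Record free_lq := FreeLq {
  fl_rank : nat; fl_deg : 'I_fl_rank -> nat; fl_module : lq_module K n fl_deg }.

(** Choice turns the mere existence in [syzygy_lq] into the data that [res_data] requires. *)
Definition syzygy_module (X : free_lq) : free_lq :=
  FreeLq (sval (constructive_indefinite_description _ (syzygy_lq (fl_module X)))).

Lemma lq_module_res (L : S -> Prop) (X : lq_module K n (fun _ : 'I_1 => 0%N)) :
    (forall f, L f <-> exists v : 'rV_(lq_s X), f = (v *m lq_M X) 0 0) ->
  exists F : res_data K n, [/\ min_graded_res F L,
    forall i (a : 'I_(res_rank F i)), exists b, res_deg a = (lq_e X b + i)%N &
    forall b, exists a : 'I_(res_rank F 0), res_deg a = lq_e X b].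
Proof.
move=> LX; pose T i := iter i syzygy_module (FreeLq X).
have spec i := svalP (constructive_indefinite_description _ (syzygy_lq (fl_module (T i)))).
(* The generators of [T i] are a basis of [F_i], so the map from [F_(i+1)] to [F_i] is the matrix of
   [T i.+1]. *)
pose F := @ResData K n (fun i => lq_s (fl_module (T i))) (fun i => lq_e (fl_module (T i)))
  (lq_M X) (fun i => lq_M (fl_module (T i.+1))).
exists F; split=> [|i a|b]; last by exists b.
  split=> [a|i a b m|//|v|i v|i a b].
  - by apply/dhomogP => m /lq_graded /=; rewrite addn0.
  - exact: lq_graded.
  - by have [+ _ _] := spec 0%N; apply.
  - by have [+ _ _] := spec i.+1; apply.
  - by have [_ + _] := spec i; apply.
elim: i a => [|i IHi] a; first by exists a; rewrite addn0.
have [_ _ /(_ a)[b eb]] := spec i; have [c ec] := IHi b.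
by exists c; rewrite addnS -ec.
Qed.

Definition colon_vars (s : seq 'X_{1..n}) (i : nat) : {set 'I_n} :=
  [set l | has (fun v => (v <= U_(l) + nth 0 s i)%MM) (take i s)].

(** With [u] the [i]-th monomial, the colon ideal is generated by the [v / gcd(v, u)]; the condition
    says that each of them is divisible by a variable of the colon ideal. *)
Definition has_linear_quotients (s : seq 'X_{1..n}) :=
  forall i, (i < size s)%N -> forall v, v \in take i s ->
    exists2 l, l \in colon_vars s i & (nth 0%MM s i l < v l)%N.

Lemma colon_varsP s i m : has_linear_quotients s -> (i < size s)%N ->
  has (fun v => (v <= m + nth 0 s i)%MM) (take i s) <->
  exists2 l, l \in colon_vars s i & (0 < m l)%N.
Proof.
move=> lqs lt_is; split=> [/hasP[v vs /mnm_lepP le_v]|[l]].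
  have [l lA lt_l] := lqs _ lt_is _ vs; exists l => //.
  by have := le_v l; rewrite mnmDE; lia.
rewrite inE => /hasP[v vs le_v] ml; apply/hasP; exists v => //.
apply: lepm_trans le_v _; apply/mnm_lepP => j; rewrite !mnmDE mnm1E leq_add2r.
by case: eqP => [<-|].
Qed.

Lemma monom_colonP s i f : has_linear_quotients s -> (i < size s)%N ->
  monom_ideal (take i s) (f * 'X_[nth 0%MM s i]) <->
  vars_ideal (colon_vars s i) (f : S).
Proof.
move=> lqs lt_is; split=> [/monom_idealP sf|/vars_idealP sf].
  apply/vars_idealP => m mf; apply/colon_varsP => //; rewrite addmC; apply: sf.
  by rewrite addmC mcoeff_msupp addmC mcoeffMX -mcoeff_msupp.
apply/monom_idealP => m; rewrite (perm_mem (msuppMX _ _)) => /mapP[u /sf uA ->].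
by rewrite addmC; apply/colon_varsP.
Qed.

Lemma monom_ideal_rowspan s (Q : pred 'I_(size s)) t (f : S) :
    (forall v, v \in t -> exists2 j, Q j & v = nth 0%MM s j) ->
    monom_ideal t f ->
  in_rowspan (\matrix_(i < size s, b < 1) 'X_[nth 0%MM s i]) Q (f *: const_mx 1).
Proof.
move=> tQ; pose M := \matrix_(i < size s, b < 1) ('X_[nth 0%MM s i] : S).
apply: (@ideal_gen_sub _ _ (fun g => in_rowspan M Q (g *: const_mx 1))) => [|g [v vt ->]].
  split=> [|g h|a g]; rewrite ?scale0r ?scalerDl -?scalerA.
  - exact: in_rowspan0.
  - exact: in_rowspanD.
  - exact: in_rowspanZ.
have [j Qj ->] := tQ v vt.
suff -> : 'X_[nth 0%MM s j] *: const_mx 1 = row j M by apply: in_rowspan_row.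
by apply/rowP => b; rewrite !mxE mulr1.
Qed.

(** Closed by [Defined], since [monomials_res] relies on the rank and the degrees reducing to
    [size s] and [mdeg]. *)
Definition lq_of_monomials (s : seq 'X_{1..n}) :
    has_linear_quotients s -> sorted leq (map (@mdeg n) s) ->
  lq_module K n (fun _ : 'I_1 => 0%N).
Proof.
move=> lqs srt; apply: (@LQModule K n 1 _ (size s) (fun i => mdeg (nth 0%MM s i))
  (fun i => colon_vars s i) (\matrix_(i, b) 'X_[nth 0%MM s i])).
- by move=> i b m; rewrite mxE msuppX inE => /eqP->; rewrite addn0.
- move=> i j le_ij; have := sorted_leq_nth leq_trans leqnn 0%N srt.
  by move/(_ i j); rewrite !inE size_map !ltn_ord => /(_ isT isT le_ij); rewrite !(nth_map 0%MM).
move=> i f; apply: iff_trans (monom_colonP _ lqs (ltn_ord i)); split.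
  move=> [w [w0 /rowP/(_ 0)]]; rewrite !mxE => ->.
  apply: ideal_sum (ideal_gen_ideal _) _ => j _; rewrite mxE.
  have [lt_ji|le_ij] := ltnP j i; last first.
    by rewrite w0 -?leqNgt // mul0r; case: (ideal_gen_ideal
      (fun f : S => exists2 m, m \in take i s & f = 'X_[m])).
  have [_ _] := ideal_gen_ideal (fun f : S => exists2 m, m \in take i s & f = 'X_[m]); apply.
  apply: ideal_gen_incl; exists (nth 0%MM s j) => //.
  by rewrite -(nth_take _ lt_ji) mem_nth // size_take ltn_ord.
move=> fX; suff -> : f *: row i (\matrix_(i0 < size s, b < 1) 'X_[nth 0%MM s i0]) =
    (f * 'X_[nth 0%MM s i]) *: const_mx 1.
  apply: monom_ideal_rowspan fX => v /(nthP 0%MM)[j]; rewrite size_take ltn_ord => lt_ji <-.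
  by exists (Ordinal (ltn_trans lt_ji (ltn_ord i))); rewrite ?nth_take.
by apply/rowP => b; rewrite !mxE mulr1.
Defined.

Lemma monomials_res (L : S -> Prop) s :
    has_linear_quotients s -> sorted leq (map (@mdeg n) s) ->
    ideal_eq L (monom_ideal s) ->
  exists F : res_data K n, [/\ min_graded_res F L,
    forall i (a : 'I_(res_rank F i)),
      exists2 u, u \in s & res_deg a = (mdeg u + i)%N &
    forall u, u \in s -> exists a : 'I_(res_rank F 0), res_deg a = mdeg u].
Proof.
move=> lqs srt Ls; have [f|F [resF degF deg0]] := @lq_module_res L (lq_of_monomials lqs srt).
  apply: iff_trans (Ls f) _; split=> [sf|[v ->]].
    have [|w [_ /rowP/(_ 0)]] := @monom_ideal_rowspan s predT s f _ sf.
      by move=> v /(nthP 0%MM)[j lt_j <-]; exists (Ordinal lt_j).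
    by rewrite !mxE mulr1 => ->; exists w; rewrite !mxE.
  rewrite mxE; apply: ideal_sum (ideal_gen_ideal _) _ => j _; rewrite mxE.
  have [_ _] := ideal_gen_ideal (fun f : S => exists2 m, m \in s & f = 'X_[m]); apply.
  by apply: ideal_gen_incl; exists (nth 0%MM s j) => //; rewrite mem_nth.
exists F; split=> // [i a|u us].
  by have [b ->] := degF i a; exists (nth 0%MM s b); rewrite ?mem_nth.
have lt_u := us; rewrite -index_mem in lt_u.
by have [a aE] := deg0 (Ordinal lt_u); exists a; rewrite aE /= nth_index.
Qed.

End Resolution.

(** * Shifted sets of monomials *)

Section Shifted.
Variable n : nat.
Implicit Types (u v w m : 'X_{1..n}) (G s : seq 'X_{1..n}).

Definition multiple_of G m := has (fun u => (u <= m)%MM) G.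

(** The monomial [m x_j / x_i]. The subtraction is truncated, so this reading requires [0 < m i]. *)
Definition transfer m (i j : 'I_n) : 'X_{1..n} := (m - U_(i) + U_(j))%MM.

Lemma transferE m i j k : transfer m i j k = m k - (i == k) + (j == k).
Proof. by rewrite mnmDE mnmBE !mnm1E. Qed.

Lemma mdeg_transfer m i j : 0 < m i -> mdeg (transfer m i j) = mdeg m.
Proof.
move=> m_i; have le_im : (U_(i) <= m)%MM by rewrite lep1mP -lt0n.
by rewrite -{2}(submK le_im) !mdegD !mdeg1.
Qed.

Definition transfer_closed (Q : 'X_{1..n} -> Prop) :=
  forall m i j, Q m -> m j < m i -> Q (transfer m i j).

Lemma multiple_of_le G u m : multiple_of G u -> (u <= m)%MM -> multiple_of G m.
Proof.
move=> /hasP[v vG le_vu] le_um; apply/hasP; exists v => //.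
exact: lepm_trans le_vu le_um.
Qed.

(** If [u i < m i], then [u] still divides the transfer of [m]. Otherwise [u j <= m j < m i = u i],
    and the transfer of [u] divides that of [m]. *)
Lemma transfer_closed_multiple_of G :
    (forall u i j, u \in G -> u j < u i -> multiple_of G (transfer u i j)) ->
  transfer_closed (multiple_of G).
Proof.
move=> Gt m i j /hasP[u uG /mnm_lepP le_um] lt_ji.
have [lt_i|le_i] := ltnP (u i) (m i).
  apply/hasP; exists u => //; apply/mnm_lepP => k; rewrite transferE.
  by have := le_um k; case: eqP => [<-|_]; lia.
have := Gt u i j uG; move/(_ _)/multiple_of_le; apply; first by have := le_um j; lia.
apply/mnm_lepP => k; rewrite !transferE; have := le_um k; lia.
Qed.

Lemma mdeg_le u v : (u <= v)%MM -> mdeg u <= mdeg v.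
Proof. by move=> /submK<-; rewrite mdegD leq_addl. Qed.

Lemma mnm_le_mdeg_eq u v : (u <= v)%MM -> mdeg v <= mdeg u -> u = v.
Proof.
move=> le_uv; rewrite -(submK le_uv) mdegD -{2}[mdeg u]add0n leq_add2r leqn0 mdeg_eq0.
by move/eqP->; rewrite add0m.
Qed.

(** * Minimal generators and their order *)

Definition mingens G :=
  [seq u <- undup G | all (fun v => (v <= u)%MM ==> (v == u)) G].

Lemma mingensP G u :
  reflect (u \in G /\ forall v, v \in G -> (v <= u)%MM -> v = u) (u \in mingens G).
Proof.
rewrite mem_filter mem_undup; apply: (iffP andP) => -[].
  by move=> /allP uG ->; split=> // v /uG/implyP/[apply]/eqP.
move=> uG min_u; split=> //; apply/allP => v vG.
by apply/implyP => /(min_u v vG) ->.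
Qed.

Lemma mingens_multiple_of G m : multiple_of G m -> multiple_of (mingens G) m.
Proof.
case/hasP=> u uG; have [N] := ubnP (mdeg u); elim: N u uG => // N IHN u uG ltN le_um.
have [um|] := boolP (u \in mingens G); first by apply/hasP; exists u.
rewrite mem_filter mem_undup uG andbT => /allPn[v vG]; rewrite negb_imply.
case/andP=> le_vu ne_vu; apply: IHN (lepm_trans le_vu le_um) => //.
rewrite -ltnS (leq_trans _ ltN) // ltnS ltnNge.
by apply: contra ne_vu => /(mnm_le_mdeg_eq le_vu) ->.
Qed.

Definition sumsq m := \sum_i m i ^ 2.

(* The last comparison is reversed: among monomials with equal degree and equal
   sum of squares, the lexicographically larger one comes first. *)
Definition key_le u v := (mdeg u < mdeg v) ||
  (mdeg u == mdeg v) && ((sumsq u < sumsq v) || (sumsq u == sumsq v) && (v <= u)%O).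

Lemma key_le_total : total key_le.
Proof.
move=> u v; rewrite /key_le; case: (ltngtP (mdeg u) (mdeg v)) => //= _.
by case: (ltngtP (sumsq u) (sumsq v)) => //= _; rewrite le_total.
Qed.

Lemma key_le_trans : transitive key_le.
Proof.
move=> v u w; rewrite /key_le.
case: (ltngtP (mdeg u) (mdeg v)) => //= [d1 _|->].
  by case: (ltngtP (mdeg v) (mdeg w)) => //= [/(ltn_trans d1)-> //|<- _]; rewrite d1.
case: (ltngtP (mdeg v) (mdeg w)) => //= _.
case: (ltngtP (sumsq u) (sumsq v)) => //= [s1 _|->].
  by case: (ltngtP (sumsq v) (sumsq w)) => //= [/(ltn_trans s1)-> //|<- _]; rewrite s1.
case: (ltngtP (sumsq v) (sumsq w)) => //= _ le_vu le_wv; exact: le_trans le_wv le_vu.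
Qed.

Lemma key_le_anti : antisymmetric key_le.
Proof.
move=> u v; rewrite /key_le.
case: (ltngtP (mdeg u) (mdeg v)) => //= _.
by case: (ltngtP (sumsq u) (sumsq v)) => //= _; rewrite andbC; apply: le_anti.
Qed.

(** Expand [(m_i - 1)^2 + (m_j + 1)^2]; the negative term is moved across to stay in the
    naturals. *)
Lemma sumsq_transfer m i j : m j < m i ->
  sumsq (transfer m i j) + 2 * (m i).-1 = sumsq m + 2 * m j.
Proof.
move=> lt_ji; have ne_ij : j != i by apply: contraTneq lt_ji => ->; rewrite ltnn.
have split_ij F : \sum_k F k = F i + (F j + \sum_(k | (k != i) && (k != j)) F k).
  by rewrite (bigD1 i) //= (bigD1 j).
rewrite /sumsq !split_ij.
rewrite !transferE !eqxx (negPf ne_ij) [i == j]eq_sym (negPf ne_ij).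
under eq_bigr => k /andP[ki kj].
  rewrite transferE [i == k]eq_sym [j == k]eq_sym (negPf ki) (negPf kj) subn0 addn0; over.
move: (bigop _ _ _) => x; move: lt_ji; move: (m i) (m j) => a b; rewrite -!mulnn; nia.
Qed.

(** The sum of squares drops unless [u p = (u l).+1]. In that case the transfer swaps two exponents,
    and [l < p] makes the result lexicographically larger. *)
Lemma key_le_transfer u p l : u l < u p -> (u l).+1 < u p \/ l < p ->
  key_le (transfer u p l) u.
Proof.
move=> lt_lp good; rewrite /key_le mdeg_transfer; last exact: leq_ltn_trans lt_lp.
rewrite ltnn eqxx /=; have sq := sumsq_transfer lt_lp.
case: good => [lt2|lt_l]; first by apply/orP; left; lia.
have [lt2|le2] := ltnP (u l).+1 (u p); first by apply/orP; left; lia.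
apply/orP; right; apply/andP; split; first by apply/eqP; lia.
rewrite ltW //; apply/ltmcP; first by rewrite mdeg_transfer // (leq_ltn_trans _ lt_lp).
exists l => [j lt_j|]; rewrite transferE -!val_eqE /=; last by lia.
by rewrite !gtn_eqF ?subn0 ?addn0 //; apply: ltn_trans lt_j lt_l.
Qed.

Lemma exists_deficit u v : mdeg v <= mdeg u -> ~~ (v <= u)%MM -> exists j, v j < u j.
Proof.
move=> le_vu n_vu; apply/existsP; apply: contraNT n_vu.
rewrite negb_exists => /forallP le_uv.
have le_uv' : (u <= v)%MM by apply/mnm_lepP => j; rewrite leqNgt.
by rewrite (mnm_le_mdeg_eq le_uv' le_vu) lepm_refl.
Qed.

(** A unit moves from an index [l] of excess to an index [j] of deficit, which lowers the total
    excess and creates no new one. The move is allowed because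
    [v j < u j <= t <= (u l).+1 <= v l]. *)
Lemma transfer_below (Q : 'X_{1..n} -> Prop) u v t : transfer_closed Q -> Q v ->
    mdeg v <= mdeg u -> (forall i, u i <= t) ->
    (forall l, u l < v l -> t <= (u l).+1) ->
  exists w, [/\ Q w, (w <= u)%MM & mdeg w = mdeg v].
Proof.
move=> Qt + + ut; have [N] := ubnP (\sum_l (v l - u l)).
elim: N v => // N IHN v ltN Qv le_vu vt.
have [le|] := boolP (v <= u)%MM; first by exists v.
move=> n_vu; have [j lt_j] := exists_deficit le_vu n_vu.
case/forallPn: n_vu => l; rewrite -ltnNge => lt_l.
have lt_jl : v j < v l by have := vt l lt_l; have := ut j; lia.
have ne : (j == l) = false by apply: contraTF lt_jl => /eqP->; rewrite ltnn.
have mE : mdeg (transfer v l j) = mdeg v by rewrite mdeg_transfer //; lia.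
have tE k : u k < transfer v l j k -> u k < v k.
  by rewrite transferE; case: (eqVneq j k) => [<-|]; lia.
rewrite -mE; apply: IHN => [||| k /tE /vt //]; rewrite ?mE //; last exact: Qt.
rewrite -ltnS (leq_trans _ ltN) // ltnS (bigD1 l) //= [X in _ < X](bigD1 l) //=.
rewrite -addSn leq_add //; first by rewrite transferE eqxx ne; lia.
apply: leq_sum => k kl; rewrite transferE [l == k]eq_sym (negPf kl).
by case: (eqVneq j k) => [<-|]; lia.
Qed.

(** This is [(b - a)(a + b - c) >= 0] without subtraction. *)
Lemma leq_sqDmul a b c : (b < a -> a + b <= c) -> (a < b -> c <= a + b) ->
  a ^ 2 + c * b <= b ^ 2 + c * a.
Proof.
rewrite -!mulnn; case: (ltngtP a b) => [lt_ab _ /(_ isT)|lt_ba /(_ isT) + _|->] //.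
  by rewrite -(subnKC (ltnW lt_ab)); move: (b - a) => x /leq_mul/(_ (leqnn x)); nia.
by rewrite -(subnKC (ltnW lt_ba)); move: (a - b) => x /leq_mul/(_ (leqnn x)); nia.
Qed.

(* Let t = max u and let p be the last index with u_p = t.  If v exceeds u at
   some l with u_l < t - 1, or with u_l = t - 1 and l < p, then u x_l / x_p
   precedes u.  Otherwise transfers turn v into a divisor of u if deg v < deg u,
   while for equal degrees (v_i - u_i)(v_i + u_i - 2t + 1) >= 0 for all i and the
   key of v force v_i + u_i = 2t - 1 wherever u and v differ, which contradicts
   the lexicographic tie-break. *)
Lemma shifted_quotient G u v : transfer_closed (multiple_of G) ->
    u \in mingens G -> v \in mingens G -> v != u -> key_le v u ->
  exists l w, [/\ u l < v l, w \in mingens G, w != u, key_le w u &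
                 (w <= U_(l) + u)%MM].
Proof.
move=> Gt ug vg ne_vu key_vu.
have [uG min_u] := mingensP _ _ ug; have [vG min_v] := mingensP _ _ vg.
have [i0 u_i0] : exists i, 0 < u i.
  apply/existsP; apply: contraNT ne_vu; rewrite negb_exists => /forallP u0.
  by rewrite eq_sym; apply/eqP; apply: min_v => //; apply/mnm_lepP => i; have := u0 i; lia.
pose t := \max_i u i; have ut i : u i <= t by apply: leq_bigmax.
have [p0 tE] : exists p, u p == t.
  by have [|p pE] := @bigop.eq_bigmax _ u; [apply/card_gt0P; exists i0 | exists p; apply/eqP].
clearbody t.
have [p /eqP up p_max] := @arg_maxnP _ p0 (fun i => u i == t) val tE.
have [/existsP[l /andP[lt_l good]]|none] :=
    boolP [exists l, (u l < v l) && (((u l).+1 < t) || ((u l).+1 == t) && (l < p))].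
  have lt_lp : u l < u p by rewrite up; case/orP: good => [|/andP[/eqP + _]]; lia.
  have /mingens_multiple_of/hasP[w wg le_w] : multiple_of G (transfer u p l).
    by apply: Gt => //; apply/hasP; exists u; rewrite ?lepm_refl.
  exists l, w; split=> //.
  - apply: contraTneq le_w => ->; apply/forallPn; exists p.
    have lp : (l == p) = false by apply: contraTF lt_lp => /eqP->; rewrite ltnn.
    by rewrite transferE eqxx lp; lia.
  - have [lt_d|le_d] := ltnP (mdeg w) (mdeg u); first by rewrite /key_le lt_d.
    rewrite (mnm_le_mdeg_eq le_w) ?mdeg_transfer ?(leq_ltn_trans _ lt_lp) //.
    apply: key_le_transfer lt_lp _; rewrite up.
    by case/orP: good => [|/andP[_]]; [left | right].
  - apply: lepm_trans le_w _; apply/mnm_lepP => k; rewrite transferE mnmDE mnm1E; lia.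
exfalso; have {}none l : u l < v l -> t <= (u l).+1 /\ ((u l).+1 = t -> p <= l).
  move=> lt_l; have /existsPn/(_ l) := none; rewrite lt_l /= negb_or -leqNgt.
  by case/andP=> -> /nandP nl; split=> // /eqP E; case: nl => [|]; rewrite ?E // -leqNgt.
have [lt_d|le_d] := ltnP (mdeg v) (mdeg u).
  have [||w [/hasP[g gG le_gw] le_wu dw]] := transfer_below Gt _ (ltnW lt_d) ut _ (v := v).
  - by apply/hasP; exists v; rewrite ?lepm_refl.
  - by move=> l /none[].
  have := mdeg_le le_gw; rewrite (min_u g gG (lepm_trans le_gw le_wu)); lia.
move: key_vu; rewrite /key_le ltnNge le_d /= => /andP[/eqP dE key].
have pt i : u i ^ 2 + (2 * t).-1 * v i <= v i ^ 2 + (2 * t).-1 * u i.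
  apply: leq_sqDmul => [lt_v|lt_u]; have := ut i; last have [] := none i lt_u.
    by clear -lt_v; lia.
  by clear -lt_u; lia.
have sq_le : sumsq v <= sumsq u by case/orP: key => [/ltnW|/andP[/eqP->]].
have pt_eq i : u i ^ 2 + (2 * t).-1 * v i = v i ^ 2 + (2 * t).-1 * u i.
  (* A strict inequality at one index would survive summation, against equal degrees and [sq_le]. *)
  apply/eqP; rewrite eqn_leq pt leqNgt; apply/negP => lt_i.
  have : sumsq u + (2 * t).-1 * mdeg v < sumsq v + (2 * t).-1 * mdeg u.
    rewrite /sumsq !mdegE !big_distrr -!big_split /=.
    rewrite (bigD1 i) //= [X in _ < X](bigD1 i) //= -addSn.
    by apply: leq_add => //; apply: leq_sum.
  by rewrite dE ltn_add2r ltnNge sq_le.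
have sqE : sumsq u = sumsq v.
  have : \sum_i (u i ^ 2 + (2 * t).-1 * v i) = \sum_i (v i ^ 2 + (2 * t).-1 * u i).
    by apply: eq_bigr => i _; apply: pt_eq.
  by rewrite !big_split -!big_distrr /= -!mdegE dE => /addIn.
move: key; rewrite sqE ltnn eqxx /= le_eqVlt eq_sym (negPf ne_vu) /=.
case/ltmcP=> // i eq_below lt_i.
have n_vu : ~~ (v <= u)%MM.
  by apply/forallPn; exists i; rewrite -ltnNge.
have [|j lt_j] := exists_deficit _ n_vu; first by rewrite dE.
(* Where [u] and [v] differ, their exponents add up to [2t - 1]. Hence [u j = t] and [u i = t - 1],
   so [j <= p <= i]; then [j < i], where [u] and [v] agree, contradicts [v j < u j]. *)
have u_j : u j == t by have := pt_eq j; have := ut j; rewrite -!mulnn => *; apply/eqP; nia.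
have u_i : (u i).+1 = t.
  have := pt_eq i; have := ut i; have [] := none i lt_i.
  by rewrite -!mulnn; nia.
have [_ /(_ u_i) le_pi] := none i lt_i; have le_jp := p_max j u_j.
have ne_ij : j != i by apply: contraTneq lt_j => ->; rewrite -leqNgt ltnW.
have := eq_below j; rewrite ltn_neqAle ne_ij (leq_trans le_jp le_pi) => /(_ isT).
lia.
Qed.

End Shifted.

(** * Shifted monomial ideals *)

Section ShiftedIdeals.
Local Open Scope ring_scope.
Variables (K : fieldType) (n : nat).
Local Notation S := {mpoly K[n]}.
Implicit Types (G s : seq 'X_{1..n}) (L : S -> Prop).

Definition lqgens G := sort (@key_le n) (mingens G).

Lemma mem_lqgens G u : (u \in lqgens G) = (u \in mingens G).
Proof. by rewrite mem_sort. Qed.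

Lemma lqgens_uniq G : uniq (lqgens G).
Proof. by rewrite sort_uniq filter_uniq // undup_uniq. Qed.

Lemma lqgens_antichain G u v :
  u \in lqgens G -> v \in lqgens G -> (v <= u)%MM -> v = u.
Proof.
rewrite !mem_lqgens => /mingensP[_ min_u] /mingensP[vG _]; exact: min_u.
Qed.

Lemma multiple_of_lqgens G m : multiple_of (lqgens G) m = multiple_of G m.
Proof.
apply/idP/idP => [/hasP[u]|/mingens_multiple_of/hasP[u um le_um]].
  by rewrite mem_lqgens => /mingensP[uG _] le_um; apply/hasP; exists u.
by apply/hasP; exists u; rewrite ?mem_lqgens.
Qed.

Lemma lqgens_key_le G i j : (i <= j < size (lqgens G))%N ->
  key_le (nth 0%MM (lqgens G) i) (nth 0%MM (lqgens G) j).
Proof.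
case/andP=> le_ij lt_j; have srt := sort_sorted (@key_le_total n) (mingens G).
have refl : reflexive (@key_le n) by move=> u; have := key_le_total u u; rewrite orbb.
by apply: (sorted_leq_nth (@key_le_trans n) refl 0%MM srt) => //; apply: leq_ltn_trans lt_j.
Qed.

Lemma lqgens_mdeg_sorted G : sorted leq (map (@mdeg n) (lqgens G)).
Proof.
rewrite sorted_map; have := sort_sorted (@key_le_total n) (mingens G).
apply: sub_sorted => u v; rewrite /key_le /=.
by case/orP=> [/ltnW //|/andP[/eqP->]].
Qed.

Lemma lqgens_linear_quotients G :
  transfer_closed (multiple_of G) -> has_linear_quotients (lqgens G).
Proof.
move=> Gt i lt_is v v_take; set u := nth _ _ i.
have vs := mem_take v_take; have us : u \in lqgens G by rewrite mem_nth.
have lt_iv : (index v (lqgens G) < i)%N by rewrite -in_take.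
have ne_vu : v != u.
  by apply: contraTneq lt_iv => ->; rewrite index_uniq ?ltnn ?lqgens_uniq.
have key_vu : key_le v u.
  by rewrite -(nth_index 0%MM vs); apply: lqgens_key_le; rewrite (ltnW lt_iv).
have [||l [w [lt_l ws ne_wu key_wu le_w]]] := shifted_quotient Gt _ _ ne_vu key_vu.
- by rewrite -mem_lqgens.
- by rewrite -mem_lqgens.
exists l => //; rewrite inE; apply/hasP; exists w => //.
(* Were [w] at position [i] or later, sorting would give [key_le u w], and antisymmetry [w = u]. *)
rewrite -mem_lqgens in ws; rewrite in_take // ltnNge; apply: contra ne_wu => le_iw.
apply/eqP/key_le_anti; rewrite key_wu -(nth_index 0%MM ws); apply: lqgens_key_le.
by rewrite le_iw index_mem.
Qed.

Lemma shifted_ideal_linear_quotients L G : transfer_closed (multiple_of G) ->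
  ideal_eq L (supported_in (multiple_of G)) -> linear_quotients L.
Proof.
move=> /lqgens_linear_quotients lqs LG; have eqL : ideal_eq L (monom_ideal (lqgens G)).
  move=> f; apply: iff_trans (LG f) (iff_sym _); apply: iff_trans (monom_idealP _ f) _.
  by split=> sf m /sf; rewrite -multiple_of_lqgens.
exists (lqgens G); split; first split=> [||t sub_t /(_ 'X_[_])Lt u us] //.
- exact: lqgens_uniq.
- have [/(_ _)/monom_idealP/supported_inX + _] := Lt u.
  have Lu : L 'X_[u].
    by apply/eqL/ideal_gen_incl; exists u.
  by move/(_ Lu)/hasP=> [v vt /(lqgens_antichain us (sub_t _ vt)) <-].
move=> i /andP[_ lt_is]; exists (colon_vars (lqgens G) i) => f.
apply: iff_trans (monom_colonP _ lqs lt_is); split=> [|fX g].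
  by apply; apply: ideal_gen_incl; exists (nth 0%MM (lqgens G) i); rewrite ?mem_head.
have [I0 ID IM] := ideal_gen_ideal
  (fun f : S => exists2 m, m \in take i (lqgens G) & f = 'X_[m]).
apply: (@ideal_gen_sub _ _ (fun g => monom_ideal _ (f * g))) => [|h [m]].
  split=> [|g1 g2 fg1 fg2|a g1 fg1]; rewrite ?mulr0 ?mulrDr 1?mulrCA //.
    exact: ID.
  exact: IM.
by rewrite inE => /eqP-> ->.
Qed.

Lemma shifted_ideal_res L G : transfer_closed (multiple_of G) ->
    ideal_eq L (supported_in (multiple_of G)) ->
  exists F : res_data K n, [/\ min_graded_res F L,
    forall i (a : 'I_(res_rank F i)),
      exists2 u, u \in mingens G & res_deg a = (mdeg u + i)%N &
    forall u, u \in mingens G -> exists a : 'I_(res_rank F 0), res_deg a = mdeg u].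
Proof.
move=> /lqgens_linear_quotients lqs LG.
have [|F [resF degF deg0]] := @monomials_res K n L _ lqs (lqgens_mdeg_sorted G).
  move=> f; apply: iff_trans (LG f) (iff_sym _); apply: iff_trans (monom_idealP _ f) _.
  by split=> sf m /sf; rewrite -multiple_of_lqgens.
exists F; split=> // [i a|u]; last by rewrite -mem_lqgens; apply: deg0.
by have [u us ->] := degF i a; exists u; rewrite -?mem_lqgens.
Qed.

Lemma shifted_ideal_reg L G r u0 : transfer_closed (multiple_of G) ->
    ideal_eq L (supported_in (multiple_of G)) ->
    {in mingens G, forall u, mdeg u <= r}%N ->
    u0 \in mingens G -> mdeg u0 = r ->
  has_reg L r.
Proof.
move=> Gt LG le_r u0G du0; have [F [resF degF deg0]] := shifted_ideal_res Gt LG.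
exists F; split=> // [i a|].
  by have [u us ->] := degF i a; rewrite leq_add2r le_r.
by have [a aE] := deg0 u0 u0G; exists 0%N, a; rewrite aE du0 addn0.
Qed.

Definition monomials_upto N : seq 'X_{1..n} :=
  [seq bmnm m | m <- enum {: 'X_{1..n < N.+1}}].

Lemma mem_monomials_upto N m : (m \in monomials_upto N) = (mdeg m <= N)%N.
Proof.
apply/mapP/idP => [[u _ ->]|le_m]; first by rewrite -ltnS bmdeg.
by exists (BMultinom (le_m : mdeg m < N.+1)%N); rewrite ?mem_enum.
Qed.

Definition mdeg_component G j : seq 'X_{1..n} :=
  [seq m <- monomials_upto j | (mdeg m == j) && multiple_of G m].

Lemma mem_mdeg_component G j m :
  (m \in mdeg_component G j) = (mdeg m == j) && multiple_of G m.
Proof. by rewrite mem_filter mem_monomials_upto; case: eqP => //= ->; rewrite leqnn andbT. Qed.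

(** Transfers preserve the degree, so each component ideal is again shifted, now with all generators
    in degree [j]; its resolution is then linear. *)
Lemma shifted_ideal_componentwise L G : transfer_closed (multiple_of G) ->
  ideal_eq L (supported_in (multiple_of G)) -> componentwise_linear L.
Proof.
move=> Gt LG; have LX m : L 'X_[m] <-> multiple_of G m.
  by apply: iff_trans (LG _) (supported_inX _ _ _).
have upG : mupclosed (multiple_of G) by move=> u m; apply: multiple_of_le.
have idL : is_ideal L.
  have [L0 LD LM] := @supported_in_ideal K n _ upG.
  by split=> [|f g /LG Lf /LG Lg|a f /LG Lf]; apply/LG; [exact: L0 | exact: LD | exact: LM].
split=> [f|j].
  split=> [Lf|]; last by apply: ideal_gen_sub => // g [].
  apply: ideal_monomials (ideal_gen_ideal _) _ => m mf; apply: ideal_gen_incl.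
  split; last by exists (mdeg m); rewrite dhomogX.
  by apply/LX; move/LG: Lf; apply.
have [||F [resF degF _]] := @shifted_ideal_res
    (ideal_gen (fun f => L f /\ f \is j.-homog)) (mdeg_component G j).
- apply: transfer_closed_multiple_of => u i l; rewrite mem_mdeg_component.
  case/andP=> du Gu lt_l; apply/hasP; exists (transfer u i l); rewrite ?lepm_refl //.
  by rewrite mem_mdeg_component mdeg_transfer ?du ?Gt // (leq_ltn_trans _ lt_l).
- move=> f; split.
    apply: ideal_gen_sub => [|g [/LG Gg /dhomogP dg] m mg].
      by apply: supported_in_ideal => u m; apply: multiple_of_le.
    apply/hasP; exists m; rewrite ?lepm_refl // mem_mdeg_component Gg // andbT.
    by apply/eqP/dg.
  move=> sf; apply: ideal_monomials (ideal_gen_ideal _) _ => m /sf/hasP[u].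
  rewrite mem_mdeg_component => /andP[/eqP du Gu] le_um; rewrite -(submK le_um) mpolyXD.
  have [_ _] := ideal_gen_ideal (fun f => L f /\ f \is j.-homog); apply.
  by apply: ideal_gen_incl; split; [apply/LX | rewrite dhomogX; apply/eqP].
exists j, F => // i a; have [u + ->] := degF i a.
by case/mingensP; rewrite mem_mdeg_component => /andP[/eqP->].
Qed.

End ShiftedIdeals.

(** * Localization, powers, weights *)

Section Localization.
Local Open Scope ring_scope.
Variable R : idomainType.
Implicit Types (I J P : R -> Prop) (f : R).

(** Clearing denominators: products of elements outside [P] stay outside [P], and [R] embeds in its
    fraction field. *)
Lemma local_extP J P f : is_ideal J -> is_prime P ->
  local_ext J P (tofrac f) <-> exists2 s, ~ P s & J (s * f).
Proof.
move=> [J0 JD JM] [[P0 _ _] P1 PM]; have nz s : ~ P s -> tofrac s != 0.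
  by move=> Ps; rewrite tofrac_eq0; apply/eqP => s0; apply: Ps; rewrite s0.
split=> [[t [tJ ft]]|[s Ps Jsf]]; last first.
  exists [:: (tofrac 1 / tofrac s, s * f)]; split=> [c|].
    by rewrite inE => /eqP->; split=> //; exists 1, s.
  by rewrite big_seq1 /= tofracM mulrA mulfVK ?nz // tofrac1 mul1r.
suff [s Ps [h Jh sh]] : exists2 s, ~ P s & exists2 h, J h &
    tofrac s * \sum_(c <- t) c.1 * tofrac c.2 = tofrac h.
  exists s => //; move: sh; rewrite -ft -tofracM => /eqP.
  by rewrite tofrac_eq => /eqP->.
elim: t tJ {ft} => [|c t IHt] tJ.
  by exists 1 => //; exists 0; rewrite // big_nil mulr0 tofrac0.
have [|s Ps [h Jh sh]] := IHt; first by move=> e et; apply: tJ; rewrite inE et orbT.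
have [[a [b [Pb cE]]] Jc] := tJ c (mem_head _ _).
exists (b * s); first by case/PM.
exists (s * a * c.2 + b * h); first by apply: JD; apply: JM.
rewrite big_cons mulrDr tofracD !tofracM -sh cE; congr (_ + _); last by rewrite mulrA.
rewrite [tofrac a / _]mulrC !mulrA; congr (_ * _ * _).
by rewrite [tofrac b * _]mulrC mulfK ?nz.
Qed.

End Localization.

(** * Powers of an ideal *)

Section IdealPowers.
Local Open Scope ring_scope.
Variable R : comNzRingType.
Implicit Types (I : R -> Prop).

Lemma ideal_pow0 I f : ideal_pow I 0 f.
Proof.
rewrite -[f]mulr1; have [_ _] := ideal_gen_ideal (fun f => exists g : 'I_0 -> R,
  (forall i, I (g i)) /\ f = \prod_(i < 0) g i); apply.
by apply: ideal_gen_incl; exists (fun=> 0); split=> [[]|]; rewrite ?big_ord0.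
Qed.

Lemma ideal_powS I k a b : I a -> ideal_pow I k b -> ideal_pow I k.+1 (a * b).
Proof.
move=> Ia; apply: (@ideal_gen_sub _ _ (fun b => ideal_pow I k.+1 (a * b))).
  have [I0 ID IM] := ideal_gen_ideal (fun f => exists g : 'I_k.+1 -> R,
    (forall i, I (g i)) /\ f = \prod_(i < k.+1) g i).
  split=> [|f g If Ig|c f If]; rewrite ?mulr0 ?mulrDr 1?mulrCA //.
    exact: ID.
  exact: IM.
move=> _ [g [Ig ->]]; apply: ideal_gen_incl.
exists (fun i => if unlift ord0 i is Some j then g j else a).
split=> [i|]; first by case: unliftP.
by rewrite big_ord_recl unlift_none; congr (_ * _); apply: eq_bigr => i _; rewrite liftK.
Qed.

End IdealPowers.

(** * Weights and truncated degrees of exponents *)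

Section Weights.
Variable n : nat.
Implicit Types (m u v : 'X_{1..n}) (A B : {set 'I_n}).

Definition wt A m := \sum_(i in A) m i.

Definition cap k m := \sum_i minn (m i) k.

Definition mset B : 'X_{1..n} := [multinom (i \in B : nat) | i < n].

Lemma mset_le B m : (forall i, i \in B -> 0 < m i) -> (mset B <= m)%MM.
Proof. by move=> Bm; apply/mnm_lepP => i; rewrite mnmE; case: (boolP (i \in B)) => // /Bm. Qed.

Lemma mdeg_mset B : mdeg (mset B) = #|B|.
Proof.
rewrite mdegE -sum1_card [RHS]big_mkcond; apply: eq_bigr => i _.
by rewrite mnmE; case: (i \in B).
Qed.

Lemma exists_set_between (T U : {set 'I_n}) d : T \subset U -> #|T| <= d <= #|U| ->
  exists B : {set 'I_n}, [/\ T \subset B, B \subset U & #|B| = d].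
Proof.
move=> TU /andP[]; move: {-2}d (leqnn d) => e.
elim: e => [|e IHe] le_ed le_T le_U.
  by exists T; split=> //; apply/eqP; rewrite -leqn0.
move: le_T; rewrite leq_eqVlt => /orP[/eqP T_e|le_T]; first by exists T.
have [||| B [TB BU Be]] := IHe => //; [exact: ltnW | exact: ltnW |].
have /subsetPn[i iU iB] : ~~ (U \subset B).
  by apply: contraTN le_U => /subset_leq_card; rewrite Be -ltnNge.
exists (i |: B); split; last by rewrite cardsU1 iB Be.
  by apply: subset_trans TB (subsetUr _ _).
by rewrite subUset sub1set iU.
Qed.

Lemma cap1 m : cap 1 m = #|[set i | 0 < m i]|.
Proof.
rewrite /cap -sum1_card [RHS]big_mkcond; apply: eq_bigr => i _.
by rewrite inE; case: (m i) => // x; rewrite minnSS minn0.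
Qed.

Lemma cap_le_mdeg k m : cap k m <= mdeg m.
Proof. by rewrite mdegE; apply: leq_sum => i _; apply: geq_minl. Qed.

Lemma cap_mono k u m : (u <= m)%MM -> cap k u <= cap k m.
Proof.
by move/mnm_lepP=> le_um; apply: leq_sum => i _; have := le_um i; lia.
Qed.

Lemma wt_mono A u m : (u <= m)%MM -> wt A u <= wt A m.
Proof. by move/mnm_lepP=> le_um; apply: leq_sum. Qed.

Lemma wtD A u v : wt A (u + v) = wt A u + wt A v.
Proof. by rewrite -big_split; apply: eq_bigr => i _; rewrite mnmDE. Qed.

(** The [d - 1] indices outside [A] contribute at most [k] each to [cap k m], which leaves at least
    [k] for [A]. *)
Lemma cap_wt k d A m : #|A| = (n - d).+1 -> 0 < d <= n -> d * k <= cap k m -> k <= wt A m.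
Proof.
move=> cA /andP[d_gt0 le_dn] le_cap; have cA' : #|~: A| = d.-1.
  by have := cardsC A; rewrite card_ord cA; lia.
have : cap k m <= wt A m + d.-1 * k.
  rewrite /cap (bigID (mem A)) /= leq_add //; first by apply: leq_sum => i _; apply: geq_minl.
  rewrite -cA' -sum_nat_const; apply: (@leq_trans (\sum_(i | i \notin A) k)).
    by apply: leq_sum => i _; apply: geq_minr.
  by apply/eq_leq/eq_bigl => i; rewrite inE.
by case: d d_gt0 le_cap {le_dn cA cA'} => //= d _; rewrite mulSn; lia.
Qed.

Lemma sum_split2 (i j : 'I_n) (F : 'I_n -> nat) : j != i ->
  \sum_k F k = F i + (F j + \sum_(k | (k != i) && (k != j)) F k).
Proof. by move=> ne; rewrite (bigD1 i) //= (bigD1 j). Qed.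

(** Concavity of [x |-> min(x, k)]: moving a unit from a larger to a smaller exponent does not lower
    the sum. *)
Lemma cap_transfer k m i j : m j < m i -> cap k m <= cap k (transfer m i j).
Proof.
move=> lt_ji; have ne_ji : j != i by apply: contraTneq lt_ji => ->; rewrite ltnn.
rewrite /cap !(sum_split2 _ ne_ji) !addnA leq_add //.
  by rewrite !transferE !eqxx (negPf ne_ji) [i == j]eq_sym (negPf ne_ji); lia.
apply: leq_sum => l /andP[li lj].
by rewrite transferE [i == l]eq_sym [j == l]eq_sym (negPf li) (negPf lj) subn0 addn0.
Qed.

(** Bounds the degrees of the generators. Lowering an exponent above [k] costs nothing; if there is
    none, [cap k m] is the degree and any positive exponent can be lowered. *)
Lemma cap_lower k m N : N <= cap k m -> N < mdeg m ->
  exists2 i, 0 < m i & N <= cap k (m - U_(i))%MM.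
Proof.
move=> le_N lt_N; have [/existsP[i lt_i]|/existsPn le_k] := boolP [exists i, k < m i].
  exists i; first exact: leq_ltn_trans lt_i.
  apply: leq_trans le_N _; apply: leq_sum => j _; rewrite mnmBE mnm1E.
  by case: eqP => [<-|_]; lia.
have capE : cap k m = mdeg m.
  by rewrite mdegE; apply: eq_bigr => i _; have := le_k i; rewrite -leqNgt => /minn_idPl.
have /existsP[i m_i] : [exists i, 0 < m i].
  apply: contraTT lt_N; rewrite negb_exists => /forallP m0.
  by rewrite mdegE big1 // => i _; have := m0 i; lia.
exists i => //; have le_im : (U_(i) <= m)%MM by rewrite lep1mP -lt0n.
suff -> : cap k (m - U_(i))%MM = (mdeg m).-1 by lia.
transitivity (mdeg (m - U_(i))%MM).
  rewrite mdegE; apply: eq_bigr => j _; apply/minn_idPl; rewrite mnmBE.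
  by have := le_k j; rewrite -leqNgt; lia.
by rewrite -{2}(submK le_im) mdegD mdeg1 addn1.
Qed.

(** Membership of [x^m] in the intersection of the [k]-th powers of all primes generated by
    [n - d + 1] variables; boolean, so that it can filter a finite list. *)
Definition sympow_exponent d k m :=
  [forall A : {set 'I_n}, (#|A| == (n - d).+1) ==> (k <= wt A m)].

Lemma sympow_exponentP d k m :
  reflect (forall A : {set 'I_n}, #|A| = (n - d).+1 -> k <= wt A m) (sympow_exponent d k m).
Proof.
apply: (iffP forallP) => [mA A /eqP cA|mA A]; first by have /implyP := mA A; apply.
by apply/implyP => /eqP /mA.
Qed.

(** The weight on [A] can only drop if [i] is in [A] and [j] is not. Then it drops by one and, as
    [m j < m i], stays at least the weight of [m] on [A] with [i] replaced by [j]. *)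
Lemma sympow_transfer d k : transfer_closed (sympow_exponent d k).
Proof.
move=> m i j /sympow_exponentP mA lt_ji; apply/sympow_exponentP => A cA.
have ne_ji : j != i by apply: contraTneq lt_ji => ->; rewrite ltnn.
have [iA|iA] := boolP (i \in A); last first.
  apply: leq_trans (mA A cA) _; apply: leq_sum => l lA; rewrite transferE.
  by have -> : (i == l) = false; [apply: contraNF iA => /eqP-> | rewrite subn0 leq_addr].
have rest B : j \notin B -> i \notin B -> wt B (transfer m i j) = wt B m.
  move=> jB iB; apply: eq_bigr => l lB; rewrite transferE.
  have -> : (i == l) = false by apply: contraNF iB => /eqP->.
  by have -> : (j == l) = false; [apply: contraNF jB => /eqP-> | rewrite subn0 addn0].
have ti : transfer m i j i = (m i).-1 by rewrite transferE eqxx (negPf ne_ji); lia.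
have tj : transfer m i j j = (m j).+1.
  by rewrite transferE eqxx eq_sym (negPf ne_ji); lia.
have [jA|jA] := boolP (j \in A).
  apply: leq_trans (mA A cA) _; rewrite /wt !(big_setD1 i iA) /=.
  have jA' : j \in A :\ i by rewrite !inE ne_ji.
  rewrite !(big_setD1 j jA') /= -!/(wt _ _) rest ?inE ?eqxx ?andbF //.
  by rewrite ti tj; lia.
have cA' : #|j |: A :\ i| = (n - d).+1.
  rewrite cardsU1 !inE (negPf jA) andbF /= -cA (cardsD1 i A) iA //.
apply: leq_trans (mA _ cA') _; rewrite /wt (big_setD1 i iA) big_setU1 ?inE ?(negPf jA) ?andbF //=.
rewrite -!/(wt _ _) rest ?ti ?leq_add2r ?inE ?eqxx ?(negPf jA) ?andbF //; lia.
Qed.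

Lemma sympow_lower d k m : 0 < d <= n -> sympow_exponent d k m -> d * k < mdeg m ->
  exists2 i, 0 < m i & sympow_exponent d k (m - U_(i))%MM.
Proof.
move=> /andP[d_gt0 le_dn] /sympow_exponentP mA lt_m.
have [/existsP[i lt_i]|/existsPn le_k] := boolP [exists i, k < m i].
  exists i; first exact: leq_ltn_trans lt_i.
  apply/sympow_exponentP => A cA; have [iA|iA] := boolP (i \in A).
    by rewrite /wt (big_setD1 i iA) /= mnmBE mnm1E eqxx; lia.
  rewrite (leq_trans (mA A cA)) //; apply: leq_sum => j jA; rewrite mnmBE mnm1E.
  by have -> : (i == j) = false; [apply: contraNF iA => /eqP-> | rewrite subn0].
have /existsP[i m_i] : [exists i, 0 < m i].
  apply: contraTT lt_m; rewrite negb_exists => /forallP m0.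
  by rewrite mdegE big1 // => i _; have := m0 i; lia.
exists i => //; apply/sympow_exponentP => A cA.
have cA' : #|~: A| = d.-1 by have := cardsC A; rewrite card_ord cA; lia.
have mE : mdeg m <= wt A m + d.-1 * k.
  rewrite mdegE (bigID (mem A)) /= leq_add2l -cA' -sum_nat_const.
  apply: (@leq_trans (\sum_(j | j \notin A) k)).
    by apply: leq_sum => j _; have := le_k j; rewrite -leqNgt.
  by apply/eq_leq/eq_bigl => j; rewrite inE.
have lt_k : k < wt A m by case: d d_gt0 lt_m mE {mA le_dn cA cA'} => //= d _; rewrite mulSn; lia.
have le_im : (U_(i) <= m)%MM by rewrite lep1mP -lt0n.
have : wt A m = wt A (m - U_(i))%MM + wt A U_(i)%MM by rewrite -wtD submK.
suff : wt A U_(i)%MM <= 1 by lia.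
by rewrite -(mdeg1 i) mdegE [X in _ <= X](bigID (mem A)) leq_addr.
Qed.

Definition bounded_gens N (Q : pred 'X_{1..n}) := [seq m <- monomials_upto n N | Q m].

Lemma multiple_of_bounded_gens N (Q : pred 'X_{1..n}) m : mupclosed Q ->
    (forall m, Q m -> N < mdeg m -> exists2 i, 0 < m i & Q (m - U_(i))%MM) ->
  multiple_of (bounded_gens N Q) m = Q m.
Proof.
move=> upQ lowerQ; apply/idP/idP => [/hasP[u]|].
  by rewrite mem_filter => /andP[Qu _]; apply: upQ.
have [D] := ubnP (mdeg m); elim: D m => // D IHD m ltD Qm.
have [le_m|lt_m] := leqP (mdeg m) N.
  by apply/hasP; exists m; rewrite ?lepm_refl // mem_filter Qm mem_monomials_upto.
have [i m_i Qmi] := lowerQ m Qm lt_m.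
have le_im : (U_(i) <= m)%MM by rewrite lep1mP -lt0n.
apply: multiple_of_le (IHD _ _ Qmi) (lem_subr _ _).
by move: ltD; rewrite -{1}(submK le_im) mdegD mdeg1 addn1 ltnS.
Qed.

End Weights.

(** * Powers of the squarefree Veronese ideal *)

Section Veronese.
Local Open Scope ring_scope.
Variables (K : fieldType) (n d : nat).
Hypothesis hd : (0 < d <= n)%N.
Local Notation S := {mpoly K[n]}.
Local Notation I := (@sqfree_veronese K n d).
Implicit Types (f g : S) (m u : 'X_{1..n}) (A B : {set 'I_n}).

Lemma sqfree_veronese_mset B : #|B| = d -> I 'X_[mset B].
Proof.
move=> cB; apply: ideal_gen_incl; exists (mset B); rewrite mdeg_mset; split=> // i.
by rewrite mnmE leq_b1.
Qed.

Lemma sqfree_veroneseP f : I f <-> supported_in (fun m => d <= cap 1 m)%N f.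
Proof.
split.
  apply: ideal_gen_sub => [|_ [m [dm m1 ->]]].
    by apply: supported_in_ideal => u m le_u /(cap_mono 1); apply: leq_trans.
  apply/supported_inX; rewrite -dm mdegE; apply: leq_sum => i _.
  by rewrite (minn_idPl (m1 i)).
move=> sf; apply: ideal_monomials (ideal_gen_ideal _) _ => m /sf; rewrite cap1 => le_d.
have [||B [_ /subsetP Bm cB]] := @exists_set_between n set0 [set i | 0 < m i]%N d.
- exact: sub0set.
- by rewrite cards0.
have le_Bm : (mset B <= m)%MM by apply: mset_le => i /Bm; rewrite inE.
rewrite -(submK le_Bm) mpolyXD; have [_ _] := ideal_gen_ideal
  (fun f : S => exists m, [/\ mdeg m = d, forall i, (m i <= 1)%N & f = 'X_[m]]); apply.
exact: sqfree_veronese_mset.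
Qed.

(** A squarefree generator [mset B] is split off, with [B] inside the support. If [d] exponents
    exceed [k], [B] is chosen among them and keeps [d] exponents at least [k]. Otherwise [B]
    contains all of them, and passing from [cap k.+1] to [cap k] loses at most [d]. *)
Lemma ideal_pow_monomial k m : (d * k <= cap k m)%N -> ideal_pow I k 'X_[m].
Proof.
elim: k m => [|k IHk] m le_cap; first exact: ideal_pow0.
pose T := [set i | k < m i]%N; pose U := [set i | 0 < m i]%N.
have TU : T \subset U by apply/subsetP => i; rewrite !inE; apply: leq_ltn_trans.
suff [B [BU cB capB]] : exists B, [/\ B \subset U, #|B| = d &
    (d * k <= cap k (m - mset B)%MM)%N].
  have le_Bm : (mset B <= m)%MM by apply: mset_le => i /(subsetP BU); rewrite inE.
  rewrite -(submK le_Bm) addmC mpolyXD; apply: ideal_powS (sqfree_veronese_mset cB) _.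
  exact: IHk.
have [le_dT|lt_Td] := leqP d #|T|.
  have [||B [_ BT cB]] := @exists_set_between n set0 T d; rewrite ?sub0set ?cards0 //.
  exists B; split=> //; first exact: subset_trans TU.
  rewrite -cB -sum_nat_const big_mkcond; apply: leq_sum => i _; rewrite mnmBE mnmE.
  by case: (boolP (i \in B)) => // /(subsetP BT); rewrite inE; lia.
have [|B [TB BU cB]] := @exists_set_between n T U d TU.
  (* The support has at least [d] elements, since each contributes at most [k + 1] to
     [cap k.+1 m]. *)
  rewrite (ltnW lt_Td) /=; move: le_cap; apply: contraTT.
  rewrite -!ltnNge => lt_U; apply: (@leq_ltn_trans (#|U| * k.+1)); last by rewrite ltn_pmul2r.
  rewrite -sum_nat_const [X in (_ <= X)%N]big_mkcond; apply: leq_sum => i _.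
  by rewrite inE; case: (m i) => [|x]; rewrite ?min0n // geq_minr.
exists B; split=> //.
suff : (cap k.+1 m <= cap k (m - mset B)%MM + #|B|)%N by rewrite cB; lia.
rewrite -sum1_card [X in (_ + X)%N]big_mkcond -big_split; apply: leq_sum => i _.
rewrite mnmBE mnmE; have := subsetP TB i; rewrite inE.
by case: (i \in B) => //= [_|]; [lia | case: ltnP => [_ /(_ isT) // | ]; lia].
Qed.

Lemma ideal_powP k f : ideal_pow I k f <-> supported_in (fun m => d * k <= cap k m)%N f.
Proof.
have idcap j : is_ideal (@supported_in K n (fun m => d * j <= cap j m)%N).
  by apply: supported_in_ideal => u m le_u /(cap_mono j); apply: leq_trans.
split; last first.
  by move=> sf; apply: ideal_monomials (ideal_gen_ideal _) _ => m /sf/ideal_pow_monomial.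
apply: ideal_gen_sub (idcap k) _ _ => _ [g [Ig ->]].
(* The induction uses [min(a, 1) + min(b, k) <= min(a + b, k + 1)]. *)
elim: k g Ig => [|k IHk] g Ig m; first by rewrite muln0.
rewrite big_ord_recl => /msuppM_le/allpairsP[[u v] /= []].
move/sqfree_veroneseP: (Ig ord0) => /[apply] cap_u.
move/(IHk _ (fun i => Ig (lift ord0 i))) => cap_v ->.
rewrite mulnS (leq_trans (leq_add cap_u cap_v)) // -big_split.
by apply: leq_sum => i _; rewrite mnmDE /=; lia.
Qed.

(** * Primes generated by variables, and the symbolic powers *)

Lemma supp_wt A f : vars_ideal A f <-> supported_in (fun m => 0 < wt A m)%N f.
Proof.
apply: iff_trans (vars_idealP A f) _; split=> sf m /sf.
  by case=> i iA m_i; rewrite /wt (big_setD1 i iA) /= addn_gt0 m_i.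
by rewrite lt0n sum_nat_eq0 => /forall_inPn[i iA]; rewrite -lt0n; exists i.
Qed.

(* Passing to the parts of minimal A-weight of both factors, whose product is
   nonzero. *)
Lemma supported_in_wt_mul A k f g m0 : m0 \in msupp f -> wt A m0 = 0%N ->
    supported_in (fun m => k <= wt A m)%N (f * g) ->
  supported_in (fun m => k <= wt A m)%N g.
Proof.
move=> m0f m0_wt sfg m1 m1g; rewrite leqNgt; apply/negP => lt_m1.
have exw : exists w, has (fun m => wt A m == w) (msupp g).
  by exists (wt A m1); apply/hasP; exists m1.
case: (ex_minnP exw) => w /hasP[m2 m2g /eqP m2w] min_w.
have lt_wk : (w < k)%N.
  by apply: leq_ltn_trans lt_m1; apply: min_w; apply/hasP; exists m1.
pose P v m := wt A m == v; pose f0 := mrestrict (P 0%N) f; pose g0 := mrestrict (P w) g.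
have nz : f0 * g0 != 0.
  rewrite mulf_eq0 negb_or -!msupp_eq0; apply/andP; split.
    have : m0 \in msupp f0 by rewrite msupp_mrestrict m0f /P m0_wt eqxx.
    by case: (msupp f0).
  have : m2 \in msupp g0 by rewrite msupp_mrestrict m2g /P m2w eqxx.
  by case: (msupp g0).
have [m m_fg] : exists m, m \in msupp (f0 * g0).
  case: (msupp _) (msupp_eq0 (f0 * g0)) => [|m t _]; first by rewrite (negPf nz).
  by exists m; rewrite mem_head.
have wtm : wt A m = w.
  have /allpairsP[[u v] /= []] := msuppM_le m_fg.
  by rewrite !msupp_mrestrict => /andP[/eqP wu _] /andP[/eqP wv _] ->; rewrite wtD wu wv.
suff : m \in msupp (f * g) by move/sfg; rewrite wtm leqNgt lt_wk.
have notin (p q : S) : {in msupp p & msupp q, forall u v, w < wt A u + wt A v}%N -> (p * q)@_m = 0.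
  move=> pq; apply: memN_msupp_eq0; apply/negP => /msuppM_le/allpairsP[[u v] /= [up vq mE]].
  by have := pq u v up vq; rewrite -wtD -mE wtm ltnn.
(* As [w] is the least weight in [g], the last two products have only weights above [w] and do not
   affect the coefficient of [m]. *)
have -> : f * g = f0 * g0 + f0 * mrestrict (predC (P w)) g + mrestrict (predC (P 0%N)) f * g.
  by rewrite -mulrDr -mrestrict_split -mulrDl -mrestrict_split.
rewrite mcoeff_msupp !mcoeffD (notin f0 (mrestrict (predC (P w)) g))
  ?(notin (mrestrict (predC (P 0%N)) f) g) ?addr0 -?mcoeff_msupp // => u v.
  rewrite msupp_mrestrict /= /P => /andP[wu _] vg.
  have : (w <= wt A v)%N by apply: min_w; apply/hasP; exists v.
  lia.
rewrite !msupp_mrestrict /= /P => _ /andP[wv vg].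
have : (w <= wt A v)%N by apply: min_w; apply/hasP; exists v.
lia.
Qed.

Lemma not_supported_in (Q : pred 'X_{1..n}) f : ~ supported_in Q f ->
  exists2 m, m \in msupp f & ~~ Q m.
Proof.
move=> nQ; have [/allP sf|/allPn //] := boolP (all Q (msupp f)).
by case: nQ => m /sf.
Qed.

(** The powers of a prime generated by variables are primary; the case [k = 1] gives primality
    itself. *)
Lemma vars_ideal_mul_notin A f g k : ~ vars_ideal A f ->
  supported_in (fun m => k <= wt A m)%N (f * g) -> supported_in (fun m => k <= wt A m)%N g.
Proof.
move=> nf; have [m mf] : exists2 m, m \in msupp f & ~~ (0 < wt A m)%N.
  by apply: (@not_supported_in (fun m => 0 < wt A m)%N) => /supp_wt.
by rewrite -eqn0Ngt => /eqP; apply: supported_in_wt_mul mf.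
Qed.

Lemma vars_ideal_prime A : is_prime (@vars_ideal K n A).
Proof.
split=> [||f g fg]; first exact: ideal_gen_ideal.
  move=> /supp_wt/(_ 0%MM); rewrite mcoeff_msupp mcoeff1 eqxx oner_neq0 => /(_ isT).
  by rewrite /wt big1 // => i _; rewrite mnm0E.
have [/allP sf|n_f] := boolP (all (fun m => 0 < wt A m)%N (msupp f)).
  by left; apply/supp_wt.
right; apply/supp_wt; apply: (@vars_ideal_mul_notin A f); last by apply/supp_wt.
by move/supp_wt => sf; case/allPn: n_f => m /sf ->.
Qed.

Lemma wt_setC A : wt A (mset (~: A)) = 0%N.
Proof. by rewrite /wt big1 // => i iA; rewrite mnmE inE iA. Qed.

Lemma card_setC_ass A : #|A| = (n - d).+1 -> #|~: A| = d.-1.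
Proof. by move=> cA; have := cardsC A; rewrite card_ord cA; case/andP: hd; lia. Qed.

(** The witness is the product of the [d - 1] variables outside [A]: its product with a monomial
    involves at least [d] variables exactly when the monomial involves one from [A]. *)
Lemma vars_ideal_ass A : #|A| = (n - d).+1 -> ass I (vars_ideal A).
Proof.
move=> cA; split; first exact: vars_ideal_prime.
exists 'X_[mset (~: A)] => f.
have capE m : (d <= cap 1 (m + mset (~: A))%MM)%N = (0 < wt A m)%N.
  apply/idP/idP => [le_d|]; last first.
    rewrite lt0n sum_nat_eq0 => /forall_inPn[i iA]; rewrite -lt0n => m_i.
    have cA' : #|i |: ~: A| = d.
      by rewrite cardsU1 inE iA (card_setC_ass cA) add1n prednK //; case/andP: hd.
    rewrite cap1 -[X in (X <= _)%N]cA'; apply/subset_leq_card/subsetP => j.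
    by rewrite !inE mnmDE mnmE inE addn_gt0 => /orP[/eqP->|->]; rewrite ?m_i ?orbT.
  have := @cap_wt n 1 d A (m + mset (~: A))%MM cA hd; rewrite muln1 => /(_ le_d).
  by rewrite wtD wt_setC addn0.
apply: iff_trans (supp_wt A f) (iff_sym _); apply: iff_trans (sqfree_veroneseP _) _.
split=> sf m.
  by move=> mf; rewrite -capE; apply: sf; rewrite mcoeff_msupp addmC mcoeffMX -mcoeff_msupp.
by rewrite (perm_mem (msuppMX _ _)) => /mapP[u /sf + ->]; rewrite addmC capE.
Qed.

(** If [P] annihilates the class of [g], some monomial of [g] involves fewer than [d] variables.
    Take [A] disjoint from its support: [g] then has a term of weight 0, while [P g] lies in [I],
    whose monomials all have positive weight. *)
Lemma ass_sub_vars_ideal P : ass I P ->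
  exists2 A : {set 'I_n}, #|A| = (n - d).+1 & forall f, P f -> vars_ideal A f.
Proof.
case=> -[_ P1 _] [g Pg]; have [m mg] : exists2 m, m \in msupp g & ~~ (d <= cap 1 m)%N.
  apply: (@not_supported_in (fun m => d <= cap 1 m)%N) => /sqfree_veroneseP Ig.
  by apply/P1/Pg; rewrite mul1r.
rewrite -ltnNge cap1 => lt_d; set B := [set i | _] in lt_d.
have [||A [_ AB cA]] := @exists_set_between n set0 (~: B) (n - d).+1.
- exact: sub0set.
- rewrite cards0 cardsCs setCK card_ord; move: lt_d; case/andP: hd; move: #|B| => b; lia.
exists A => // f /Pg/sqfree_veroneseP sfg; apply/supp_wt.
have wt_m : wt A m = 0%N.
  rewrite /wt big1 // => i /(subsetP AB); rewrite !inE; lia.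
apply: (supported_in_wt_mul mg wt_m); rewrite mulrC => u /sfg le_d.
by apply: (@cap_wt n 1 d) => //; rewrite muln1.
Qed.

(** Localizing at the prime of each [A] gives one inclusion. For the other, every associated [P]
    lies in such a prime, so a denominator outside that prime is outside [P]. *)
Lemma symbolic_powP k f :
  symbolic_pow I k f <-> supported_in (@sympow_exponent n d k) f.
Proof.
have powI : is_ideal (ideal_pow I k) by apply: ideal_gen_ideal.
split=> [If m mf|sf P assP].
  apply/sympow_exponentP => A cA; have assA := vars_ideal_ass cA.
  have [s nAs /ideal_powP sfs] := (local_extP f powI (proj1 assA)).1 (If _ assA).
  by apply: (vars_ideal_mul_notin nAs) mf => u /sfs; apply: cap_wt.
(* Multiplication by the k-th power of the product of the variables outside A,
   which is not in P, moves f into I^k. *)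
apply/(local_extP f powI (proj1 assP)); have [A cA PA] := ass_sub_vars_ideal assP.
exists 'X_[mset (~: A) *+ k].
  move=> /PA/supp_wt/supported_inX; rewrite /wt big1 // => i iA.
  by rewrite mulmnE mnmE inE iA.
apply/ideal_powP => m; rewrite mulrC (perm_mem (msuppMX _ _)) => /mapP[u /sf].
move/sympow_exponentP/(_ A cA) => le_k ->; have cA' := card_setC_ass cA.
rewrite /cap (bigID (mem A)) /=.
have -> : (\sum_(i | i \notin A) minn ((mset (~: A) *+ k + u)%MM i) k = d.-1 * k)%N.
  rewrite -cA' -sum_nat_const; apply: eq_big => i; first by rewrite inE.
  by move=> iA; rewrite mnmDE mulmnE mnmE inE iA mul1n; lia.
suff : (k <= \sum_(i in A) minn ((mset (~: A) *+ k + u)%MM i) k)%N.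
  by case: d hd => // e _ /=; rewrite mulSn leq_add2r.
rewrite (eq_bigr (fun i => minn (u i) k)) => [|i iA]; last first.
  by rewrite mnmDE mulmnE mnmE inE iA.
(* A single exponent above [k] already contributes [k]; without one the sum is the weight itself. *)
have [/exists_inP[i iA lt_i]|] := boolP [exists i in A, k < u i]%N.
  by rewrite (big_setD1 i iA) /= (minn_idPr (ltnW lt_i)) leq_addr.
rewrite negb_exists_in => /forall_inP le_i; apply: leq_trans le_k _.
apply: leq_sum => i /le_i; rewrite -leqNgt; lia.
Qed.

(** * Finite generating sets and regularity *)

Definition sympow_gens k := bounded_gens (d * k) (@sympow_exponent n d k).

Definition pow_gens k := bounded_gens (d * k) (fun m : 'X_{1..n} => d * k <= cap k m)%N.

Lemma multiple_of_sympow_gens k m : multiple_of (sympow_gens k) m = sympow_exponent d k m.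
Proof.
apply: multiple_of_bounded_gens => [u v /sympow_exponentP uA le_uv|u].
  by apply/sympow_exponentP => A /uA /leq_trans; apply; apply: wt_mono.
exact: sympow_lower.
Qed.

Lemma multiple_of_pow_gens k m : multiple_of (pow_gens k) m = (d * k <= cap k m)%N.
Proof.
apply: (@multiple_of_bounded_gens n (d * k) (fun m => d * k <= cap k m)%N) => [u v le_u|u].
  by move/(cap_mono k); apply: leq_trans.
exact: cap_lower.
Qed.

Lemma sympow_gens_transfer k : transfer_closed (multiple_of (sympow_gens k)).
Proof. by move=> m i j; rewrite !multiple_of_sympow_gens; apply: sympow_transfer. Qed.

Lemma pow_gens_transfer k : transfer_closed (multiple_of (pow_gens k)).
Proof.
move=> m i j; rewrite !multiple_of_pow_gens => le_m /(cap_transfer k).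
exact: leq_trans.
Qed.

Lemma sympow_gensE k :
  ideal_eq (symbolic_pow I k) (supported_in (multiple_of (sympow_gens k))).
Proof.
move=> f; apply: iff_trans (symbolic_powP k f) _.
by split=> sf m /sf; rewrite multiple_of_sympow_gens.
Qed.

Lemma pow_gensE k : ideal_eq (ideal_pow I k) (supported_in (multiple_of (pow_gens k))).
Proof.
move=> f; apply: iff_trans (ideal_powP k f) _.
by split=> sf m /sf; rewrite multiple_of_pow_gens.
Qed.

Lemma bounded_gens_mdeg N (Q : pred 'X_{1..n}) :
  {in mingens (bounded_gens N Q), forall u, mdeg u <= N}%N.
Proof. by move=> u /mingensP[]; rewrite mem_filter mem_monomials_upto => /andP[]. Qed.

Lemma mdeg_msetMn B k : mdeg (mset B *+ k)%MM = (#|B| * k)%N.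
Proof. by rewrite mdegMn mdeg_mset. Qed.

Lemma exists_set_card : exists B : {set 'I_n}, #|B| = d.
Proof.
have [||B [_ _ cB]] := @exists_set_between n set0 setT d; last by exists B.
  exact: sub0set.
by rewrite cards0 cardsT card_ord; case/andP: hd.
Qed.

(** The degree [d * k] is attained by the [k]-th power of a squarefree generator, which is shown to
    be a minimal generator. *)
Lemma symbolic_pow_reg k : has_reg (symbolic_pow I k) (d * k).
Proof.
have [B cB] := exists_set_card; pose u0 := (mset B *+ k)%MM.
have u0E i : u0 i = (if i \in B then k else 0)%N.
  by rewrite mulmnE mnmE; case: (i \in B); rewrite ?mul1n.
have du0 : mdeg u0 = (d * k)%N by rewrite mdeg_msetMn cB.
have wt_u0 A : #|A| = (n - d).+1 -> (k <= wt A u0)%N.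
  move=> cA; apply: (@cap_wt n k d A u0 cA hd).
  rewrite -du0 mdegE; apply: leq_sum => i _; rewrite u0E; case: ifP => _; lia.
apply: (shifted_ideal_reg (@sympow_gens_transfer k) (@sympow_gensE k) _ _ du0).
  exact: bounded_gens_mdeg.
apply/mingensP; split.
  by rewrite mem_filter mem_monomials_upto du0 leqnn andbT; apply/sympow_exponentP.
move=> v; rewrite mem_filter => /andP[/sympow_exponentP vA _] le_v.
apply/mnmP => b; have /mnm_lepP/(_ b) := le_v; rewrite u0E; case: ifP => [bB|_]; last by lia.
move=> le_vb; apply/eqP; rewrite eqn_leq le_vb /=.
(* This set meets [B] only in [b], and [v] vanishes outside [B], so its weight is [v b]. *)
have cA : #|~: (B :\ b)| = (n - d).+1.
  have cBb : #|B :\ b| = d.-1 by rewrite -cB (cardsD1 b B) bB.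
  by rewrite cardsCs setCK card_ord cBb; case/andP: hd; lia.
rewrite (leq_trans (vA _ cA)) // /wt (big_setD1 b) ?inE ?eqxx //= big1 ?addn0 // => i.
rewrite !inE => /andP[ib]; rewrite ib /= => iB.
by have /mnm_lepP/(_ i) := le_v; rewrite u0E (negPf iB); lia.
Qed.

(** Every minimal generator [u] has degree [d * k], because [d * k <= cap k u <= mdeg u]; the [k]-th
    power of a squarefree generator shows that there is one. *)
Lemma ideal_pow_reg k : has_reg (ideal_pow I k) (d * k).
Proof.
have [B cB] := exists_set_card.
have : multiple_of (pow_gens k) (mset B *+ k)%MM.
  rewrite multiple_of_pow_gens -cB -mdeg_msetMn mdegE; apply: leq_sum => i _.
  by rewrite mulmnE mnmE; case: (i \in B); lia.
case/mingens_multiple_of/hasP=> u ug _.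
have le_u := bounded_gens_mdeg ug.
apply: (shifted_ideal_reg (@pow_gens_transfer k) (@pow_gensE k) _ ug).
  exact: bounded_gens_mdeg.
apply/eqP; rewrite eqn_leq le_u /=; case/mingensP: ug; rewrite mem_filter => /andP[le_c _] _.
exact: leq_trans le_c (cap_le_mdeg _ _).
Qed.

End Veronese.

Theorem corollary3p3 (K : fieldType) (n d : nat) (hd : (1 <= d <= n)%N) :
  (forall k : nat, (1 <= k)%N ->
     linear_quotients (symbolic_pow (@sqfree_veronese K n d) k) /\
     componentwise_linear (symbolic_pow (@sqfree_veronese K n d) k)) /\
  (forall k : nat, (1 <= k)%N ->
     has_reg (symbolic_pow (@sqfree_veronese K n d) k) (d * k) /\
     has_reg (ideal_pow (@sqfree_veronese K n d) k) (d * k)).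
Proof.
split=> k _; split.
- exact: shifted_ideal_linear_quotients (@sympow_gens_transfer n d hd k) (@sympow_gensE K n d hd k).
- exact: shifted_ideal_componentwise (@sympow_gens_transfer n d hd k) (@sympow_gensE K n d hd k).
- exact: symbolic_pow_reg.
- exact: ideal_pow_reg.
Qed.
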